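(* Let $(\omega_t, J_t)$ be a solution of symplectic curvature flow on a manifold $M^{2n}$, with associated metrics $g_t$, Chern connections $\nabla$ and Chern torsions $\tau$. Then along the flow the almost complex structure evolves by $$\left(\tfrac{\partial J}{\partial t}\right)_i^k = 4\,\omega^{re}\left(\nabla_r \tau_{ei}^k\right).$$
   Context: Conventions. An almost Kähler manifold $(M^{2n},g,J,\omega)$ is a smooth manifold with Riemannian metric $g$, almost complex structure $J$ (with $J\partial_i=J_i^k\partial_k$), $g(JX,JY)=g(X,Y)$, and $\omega(X,Y):=g(JX,Y)$ closed, i.e. $\omega_{ij}=J_i^a g_{ja}$, $d\omega=0$; any two of $g,J,\omega$ determine the third. Set $\omega^{ij}:=J^i_s g^{js}$, so that $\omega^{ac}\omega_{cb}=\delta^a_b$. Repeated indices are summed. Chern connection: $\nabla=\partial+\Upsilon$ is the unique connection with $\nabla\omega=0$, $\nabla J=0$ and torsion $\tau_{ij}^k:=\Upsilon_{ij}^k-\Upsilon_{ji}^k$ satisfying $\tau_{ij}^k=-J_i^aJ_j^b\tau_{ab}^k$ (vanishing $(1,1)$ part). $\tau_{ijk}:=\tau_{ij}^l g_{lk}$. Its curvature $\Omega$ is defined by $[\nabla_a,\nabla_b]X^k=\Omega_{abd}^kX^d-\tau_{ab}^e\nabla_eX^k$, and $\Omega_{abcd}:=\Omega_{abc}^kg_{kd}$. $\mathrm{Rc}$ is the Ricci tensor of $g$. Define $P_{ab}:=\omega^{cd}\Omega_{abcd}$. For a 2-tensor $A$, $A^{2,0+0,2}_{ij}:=\tfrac12(A_{ij}-J_i^sJ_j^uA_{su})$.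 Symplectic curvature flow: one-parameter families of almost Kähler structures $(\omega_t,J_t)$ (with metric $g_t$) solving $$\left(\tfrac{\partial\omega}{\partial t}\right)_{ij}=-P_{ij},\qquad \left(\tfrac{\partial J}{\partial t}\right)_i^k=-\left(P^{2,0+0,2}_{iw}-2J_i^e\mathrm{Rc}^{2,0+0,2}_{ew}\right)g^{wk}.$$ *)

(* Defs.v *)
From mathcomp Require Import all_boot all_order all_algebra.
From mathcomp Require Import all_classical all_reals all_analysis.
Set Implicit Arguments.
Unset Strict Implicit.
Unset Printing Implicit Defensive.
Import Order.TTheory GRing.Theory Num.Theory numFieldNormedType.Exports.
Local Open Scope classical_set_scope.
Local Open Scope ring_scope.

(* On an open subset of a finite-dimensional space this is C^oo: the iterated
   directional derivatives of f in the directions vs all exist and are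
   continuous. *)
Definition smooth_on (R : realType) (V W : normedModType R)
    (U : set V) (f : V -> W) : Prop :=
  forall (vs : seq V) (x : V), U x ->
    let h := foldr (fun v k => 'D_v k) f vs in
    {for x, continuous h} /\ forall v, derivable h x v.

(* A smooth structure of dimension m on M.  [point c] is the inverse of the
   chart map [coord c : dom c -> R^m]; both are total functions that are only
   meaningful on [dom c], resp. on its image. *)
Record smooth_manifold (R : realType) (m : nat) (M : topologicalType) :=
  SmoothManifold {
    chart :> Type;
    dom : chart -> set M;
    coord : chart -> M -> 'rV[R]_m;
    point : chart -> 'rV[R]_m -> M;
    manifold_hausdorff : hausdorff_space M;
    manifold_second_countable : @second_countable M;
    chart_cover : forall p : M, exists c, dom c p;
    open_dom : forall c, open (dom c);
    open_image : forall c, open (coord c @` dom c);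
    coordK : forall c p, dom c p -> point c (coord c p) = p;
    coord_continuous : forall c, {within dom c, continuous (coord c)};
    point_continuous : forall c,
      {within coord c @` dom c, continuous (point c)};
    transition_smooth : forall c d,
      smooth_on (coord c @` (dom c `&` dom d)) (coord d \o point c) }.

Definition chart_image (R : realType) (m : nat) (M : topologicalType)
    (A : smooth_manifold R m M) (c : A) : set 'rV[R]_m := coord c @` dom c.

Definition overlap (R : realType) (m : nat) (M : topologicalType)
    (A : smooth_manifold R m M) (c d : A) : set 'rV[R]_m :=
  coord c @` (dom c `&` dom d).

Definition transition (R : realType) (m : nat) (M : topologicalType)
    (A : smooth_manifold R m M) (c d : A) : 'rV[R]_m -> 'rV[R]_m :=
  coord d \o point c.

Definition pd (R : realType) (m : nat) (i : 'I_m) (f : 'rV[R]_m -> R) :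
  'rV[R]_m -> R := fun x => 'D_(delta_mx 0 i) f x.

(* [jac c d x i a] is the partial derivative in the i-th coordinate of c of the
   a-th coordinate of d. *)
Definition jac (R : realType) (m : nat) (M : topologicalType)
    (A : smooth_manifold R m M) (c d : A) (x : 'rV[R]_m) (i a : 'I_m) : R :=
  pd i (fun y => transition c d y 0 a) x.

(* Component functions in one chart of an object with 1, ..., 4 indices.  Lower
   indices come first, then the upper one if there is one: an endomorphism
   field J has J x i k = J_i^k, i.e. J d_i = J_i^k d_k, and a connection has
   G x i j k = G_ij^k, i.e. nabla_i d_j = G_ij^k d_k. *)
Definition comp1 (R : realType) (m : nat) := 'rV[R]_m -> 'I_m -> R.
Definition comp2 (R : realType) (m : nat) := 'rV[R]_m -> 'I_m -> 'I_m -> R.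
Definition comp3 (R : realType) (m : nat) :=
  'rV[R]_m -> 'I_m -> 'I_m -> 'I_m -> R.
Definition comp4 (R : realType) (m : nat) :=
  'rV[R]_m -> 'I_m -> 'I_m -> 'I_m -> 'I_m -> R.

(* In the three records below, a field on M is given by its smooth components in
   each chart, and the change of coordinates expresses d_i = jac_i^a d'_a for
   the coordinate fields d of c and d' of d. *)
Record covariant2_field (R : realType) (m : nat) (M : topologicalType)
    (A : smooth_manifold R m M) (T : A -> comp2 R m) : Prop := {
  covariant2_smooth : forall c i j,
    smooth_on (chart_image c) (fun x => T c x i j : R^o);
  covariant2_change : forall c d x, overlap c d x -> forall i j,
    T c x i j =
      \sum_a \sum_b
        jac c d x i a * jac c d x j b * T d (transition c d x) a b }.

Record endomorphism_field (R : realType) (m : nat) (M : topologicalType)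
    (A : smooth_manifold R m M) (J : A -> comp2 R m) : Prop := {
  endomorphism_smooth : forall c i k,
    smooth_on (chart_image c) (fun x => J c x i k : R^o);
  endomorphism_change : forall c d x, overlap c d x -> forall i b,
    \sum_k J c x i k * jac c d x k b =
      \sum_a jac c d x i a * J d (transition c d x) a b }.

Record affine_connection (R : realType) (m : nat) (M : topologicalType)
    (A : smooth_manifold R m M) (G : A -> comp3 R m) : Prop := {
  connection_smooth : forall c i j k,
    smooth_on (chart_image c) (fun x => G c x i j k : R^o);
  connection_change : forall c d x, overlap c d x -> forall i j e,
    \sum_k G c x i j k * jac c d x k e =
      pd i (fun y => jac c d y j e) x
      + \sum_a \sum_b
          jac c d x i a * jac c d x j b * G d (transition c d x) a b e }.

(* [covPQ G T] is the covariant derivative of a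
    tensor with P upper and Q lower indices; the direction of differentiation
    is the first index of the result. *)

Definition cov10 (R : realType) (m : nat) (G : comp3 R m) (X : comp1 R m) :
    comp2 R m := fun x a k =>
  pd a (fun y => X y k) x + \sum_b G x a b k * X x b.

Definition cov02 (R : realType) (m : nat) (G : comp3 R m) (T : comp2 R m) :
    comp3 R m := fun x a i j =>
  pd a (fun y => T y i j) x
  - \sum_b G x a i b * T x b j - \sum_b G x a j b * T x i b.

Definition cov11 (R : realType) (m : nat) (G : comp3 R m) (T : comp2 R m) :
    comp3 R m := fun x a i k =>
  pd a (fun y => T y i k) x
  - \sum_b G x a i b * T x b k + \sum_b G x a b k * T x i b.

Definition cov12 (R : realType) (m : nat) (G : comp3 R m) (T : comp3 R m) :
    comp4 R m := fun x a i j k =>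
  pd a (fun y => T y i j k) x
  - \sum_b G x a i b * T x b j k - \sum_b G x a j b * T x i b k
  + \sum_b G x a b k * T x i j b.

Definition torsion (R : realType) (m : nat) (G : comp3 R m) : comp3 R m :=
  fun x i j k => G x i j k - G x j i k.

(* Om x a b d k = Om_abd^k is the curvature on U of the connection G
   with torsion tau:
   [nabla_a, nabla_b] X^k = Om_abd^k X^d - tau_ab^e nabla_e X^k
   for all smooth vector fields X on U. *)
Definition is_curvature (R : realType) (m : nat) (U : set 'rV[R]_m)
    (G : comp3 R m) (Om : comp4 R m) : Prop :=
  forall X : comp1 R m, (forall k, smooth_on U (fun x => X x k : R^o)) ->
  forall x, U x -> forall a b k,
    cov11 G (cov10 G X) x a b k - cov11 G (cov10 G X) x b a k =
    \sum_d Om x a b d k * X x d - \sum_e torsion G x a b e * cov10 G X x e k.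

Definition metric_inv (R : realType) (m : nat) (g : comp2 R m) : comp2 R m :=
  fun x i j => invmx (\matrix_(k, l) g x k l) i j.

Record riemannian_metric (R : realType) (m : nat) (M : topologicalType)
    (A : smooth_manifold R m M) (g : A -> comp2 R m) : Prop := {
  metric_field : covariant2_field g;
  metric_sym : forall c x, chart_image c x -> forall i j,
    g c x i j = g c x j i;
  metric_posdef : forall c x, chart_image c x ->
    forall v : 'I_m -> R, (exists i, v i != 0) ->
    0 < \sum_i \sum_j g c x i j * v i * v j }.

Record almost_complex_structure (R : realType) (m : nat) (M : topologicalType)
    (A : smooth_manifold R m M) (J : A -> comp2 R m) : Prop := {
  acs_field : endomorphism_field J;
  acs_square : forall c x, chart_image c x -> forall i l,
    \sum_k J c x i k * J c x k l = - (i == l)%:R }.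

Record almost_kahler (R : realType) (m : nat) (M : topologicalType)
    (A : smooth_manifold R m M) (g J om : A -> comp2 R m) : Prop := {
  ak_metric : riemannian_metric g;
  ak_complex : almost_complex_structure J;
  ak_compatible : forall c x, chart_image c x -> forall i j,
    \sum_a \sum_b J c x i a * J c x j b * g c x a b = g c x i j;
  ak_form : forall c x, chart_image c x -> forall i j,
    om c x i j = \sum_a J c x i a * g c x j a;
  ak_closed : forall c x, chart_image c x -> forall i j k,
    pd i (fun y => om c y j k) x + pd j (fun y => om c y k i) x
    + pd k (fun y => om c y i j) x = 0 }.

(* om^ij = J_s^i g^js; with this index order om^ac om_cb = delta^a_b. *)
Definition form_inv (R : realType) (m : nat) (g J : comp2 R m) : comp2 R m :=
  fun x i j => \sum_s J x s i * metric_inv g x j s.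

Record chern_connection (R : realType) (m : nat) (M : topologicalType)
    (A : smooth_manifold R m M) (J om : A -> comp2 R m) (G : A -> comp3 R m) :
    Prop := {
  chern_connection_field : affine_connection G;
  chern_form : forall c x, chart_image c x -> forall a i j,
    cov02 (G c) (om c) x a i j = 0;
  chern_complex : forall c x, chart_image c x -> forall a i k,
    cov11 (G c) (J c) x a i k = 0;
  chern_torsion : forall c x, chart_image c x -> forall i j k,
    torsion (G c) x i j k =
      - \sum_a \sum_b J c x i a * J c x j b * torsion (G c) x a b k }.

Record levi_civita (R : realType) (m : nat) (M : topologicalType)
    (A : smooth_manifold R m M) (g : A -> comp2 R m) (D : A -> comp3 R m) :
    Prop := {
  levi_civita_field : affine_connection D;
  levi_civita_metric : forall c x, chart_image c x -> forall a i j,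
    cov02 (D c) (g c) x a i j = 0;
  levi_civita_torsion : forall c x, chart_image c x -> forall i j k,
    torsion (D c) x i j k = 0 }.

(* The sign of Rc_bd = Rm_abd^a is positive on round spheres. *)
Definition is_ricci (R : realType) (m : nat) (M : topologicalType)
    (A : smooth_manifold R m M) (g Rc : A -> comp2 R m) : Prop :=
  exists (D : A -> comp3 R m) (Rm : A -> comp4 R m),
    [/\ levi_civita g D,
        forall c, is_curvature (chart_image c) (D c) (Rm c) &
        forall c x, chart_image c x -> forall b d,
          Rc c x b d = \sum_a Rm c x a b d a].

(* P_ab = om^cd Om_abcd with Om_abcd = Om_abc^k g_kd. *)
Definition chern_P (R : realType) (m : nat) (g J : comp2 R m) (Om : comp4 R m) :
    comp2 R m := fun x a b =>
  \sum_c \sum_d form_inv g J x c d * \sum_k Om x a b c k * g x k d.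

Definition anti_part (R : realType) (m : nat) (J T : comp2 R m) : comp2 R m :=
  fun x i j => 2^-1 * (T x i j - \sum_s \sum_u J x i s * J x j u * T x s u).

(* The derivative at t of f : I -> R; it is one-sided at an endpoint of I. *)
Definition has_time_derivative (R : realType) (I : set R) (f : R -> R)
    (t l : R) : Prop :=
  (s - t)^-1 * (f s - f t) @[s --> within I t^'] --> l.

(* The solution is (om, J).  The metrics g, Chern connections G, Chern curvatures
   Om and Ricci tensors Rc are determined by it and are carried along as data. *)
Record symplectic_curvature_flow (R : realType) (m : nat) (M : topologicalType)
    (A : smooth_manifold R m M) (I : set R) (om J g : R -> A -> comp2 R m)
    (G : R -> A -> comp3 R m) (Om : R -> A -> comp4 R m)
    (Rc : R -> A -> comp2 R m) : Prop := {
  scf_interval : is_interval I;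
  scf_nondegenerate : exists s t, [/\ I s, I t & s != t];
  scf_almost_kahler : forall t, I t -> almost_kahler (g t) (J t) (om t);
  scf_chern : forall t, I t -> chern_connection (J t) (om t) (G t);
  scf_curvature : forall t, I t ->
    forall c, is_curvature (chart_image c) (G t c) (Om t c);
  scf_ricci : forall t, I t -> is_ricci (g t) (Rc t);
  scf_form : forall t, I t -> forall c x, chart_image c x -> forall i j,
    has_time_derivative I (fun s => om s c x i j) t
      (- chern_P (g t c) (J t c) (Om t c) x i j);
  scf_complex : forall t, I t -> forall c x, chart_image c x -> forall i k,
    has_time_derivative I (fun s => J s c x i k) t
      (- \sum_w
           (anti_part (J t c) (chern_P (g t c) (J t c) (Om t c)) x i w
            - 2 * \sum_e J t c x i e * anti_part (J t c) (Rc t c) x e w)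
           * metric_inv (g t c) x w k) }.

(* Main.v *)
Require Import Defs.
From mathcomp Require Import all_boot all_order all_algebra ring lra.
From mathcomp Require Import all_classical all_reals all_analysis.
Set Implicit Arguments.
Unset Strict Implicit.
Unset Printing Implicit Defensive.
Import Order.TTheory GRing.Theory Num.Theory numFieldNormedType.Exports.
Local Open Scope classical_set_scope.
Local Open Scope ring_scope.

(* The statement is a pointwise identity between tensors.  Let
   T(X, Y, Z) = g(tau(X, Y), Z), N = nabla T and E(X, Y) = tr_g N(., ., Y, X).
   Since d omega = 0, the Chern torsion satisfies
   tau(J X, Y) = - J tau(X, Y) and T has vanishing cyclic sum; N inherits these
   symmetries because g, J and omega are parallel.  The Bianchi identity then
   determines the part of the Chern curvature that is J-anti-invariant in its
   first pair of arguments: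
     Om(X, Y, Z, W) - Om(JX, JY, Z, W)
       = N(Z; X, Y, W) + N(JZ; JX, Y, W) - N(W; X, Y, Z) - N(JW; JX, Y, Z).
   Taking traces, the anti-invariant part of P is 2 (E(Y, JX) - E(JX, Y)).  The
   Levi-Civita connection is nabla + K with g(K(X, Y), Z) = T(Y, Z, X), so the
   anti-invariant part of Rc is - E(X, Y) - E(Y, X), the terms quadratic in tau
   being J-invariant.  Adding up, the flow equation for J, lowered with g, reads
   - 4 E(Y, JX), which is the right-hand side. *)

(** Extend all forms complex-linearly. The (1,1) part of [tau] vanishes, and on two arguments of one
    type and one of the other a single term of the cyclic identity survives, so [T] lives on triples
    of one type. Over the reals this says that [J] moves freely between the three slots; a
    projection onto types becomes a finite combination of instances with [J] inserted, which linear
    arithmetic finds. The curvature components isolated from the Bianchi identity have X, Y, W of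
    one type and Z of the other. There T(tau(X, Y), Z, W) and its cyclic companions vanish: [tau]
    sends a pair of one type to the opposite type, where [T] would need Z and W as well, and it
    kills mixed pairs. Hence the curvature formula has no quadratic torsion terms. The weights of P
    and J Rc in the flow are what removes E(JX, Y): it enters with coefficient -2 from P and 2 from
    Rc. Vectors and components alternate: the torsion symmetries are algebra of vectors, but only
    identities of component functions on an open set can be differentiated, and the traces are again
    computed with vectors. *)

Section TorsionSymmetry.
Variables (R : realFieldType) (V : zmodType) (J : V -> V).
Variable B : V -> V -> V -> R.
Hypothesis JJ : forall X, J (J X) = - X.
Hypothesis BN1 : forall X Y Z, B (- X) Y Z = - B X Y Z.
Hypothesis BN3 : forall X Y Z, B X Y (- Z) = - B X Y Z.
Hypothesis Bskew : forall X Y Z, B X Y Z = - B Y X Z.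
Hypothesis BJJ : forall X Y Z, B (J X) (J Y) Z = - B X Y Z.
Hypothesis Bcycle : forall X Y Z, B X Y Z + B Y Z X + B Z X Y = 0.

Lemma closed_torsion_J12 X Y Z : B (J X) Y Z = B X (J Y) Z.
Proof.
have BN2 U1 U2 U3 : B U1 (- U2) U3 = - B U1 U2 U3 by rewrite Bskew BN1 -Bskew.
by have := BJJ X (J Y) Z; rewrite JJ BN2; lra.
Qed.

Lemma closed_torsion_J23 X Y Z : B X (J Y) Z = B X Y (J Z).
Proof.
have JZ U1 U2 U3 : B U1 (J U2) (J U3) = - B U1 U2 U3.
  (* Write a, b, c for the terms of the first cyclic sum and a', b', c' for the same terms with [J]
     on their last two arguments. The other sums give b' + c' = a, a' + c' = b, a' + b' = c, and a +
     b + c = 0 forces a' = - a. *)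
  move: (Bcycle U1 U2 U3) (Bcycle (J U1) (J U2) U3) (Bcycle U1 (J U2) (J U3))
        (Bcycle (J U1) U2 (J U3)).
  rewrite !BJJ !(closed_torsion_J12 U2) !(closed_torsion_J12 U3).
  rewrite !(closed_torsion_J12 U1); lra.
by have := JZ X Y (J Z); rewrite JJ BN3; lra.
Qed.

End TorsionSymmetry.

(** * Curvature components determined by the Bianchi identity *)

Section CurvatureAntiPart.
Variables (R : realFieldType) (V : zmodType) (J : V -> V).
Variables N Om q : V -> V -> V -> V -> R.
Hypothesis JJ : forall X, J (J X) = - X.
Hypothesis NN1 : forall W X Y Z, N (- W) X Y Z = - N W X Y Z.
Hypothesis NN2 : forall W X Y Z, N W (- X) Y Z = - N W X Y Z.
Hypothesis NJ2 : forall W X Y Z, N W X (J Y) Z = N W (J X) Y Z.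
Hypothesis NJ3 : forall W X Y Z, N W X Y (J Z) = N W (J X) Y Z.
Hypothesis ON1 : forall X Y Z W, Om (- X) Y Z W = - Om X Y Z W.
Hypothesis ON3 : forall X Y Z W, Om X Y (- Z) W = - Om X Y Z W.
Hypothesis Oskew3 : forall X Y Z W, Om X Y Z W = - Om X Y W Z.
Hypothesis OJ : forall X Y Z W, Om X Y Z (J W) = - Om X Y (J Z) W.
Hypothesis qN : forall X Y Z W, q (- X) Y Z W = - q X Y Z W.
Hypothesis qJ2 : forall X Y Z W, q X (J Y) Z W = q (J X) Y Z W.
Hypothesis qJ3 : forall X Y Z W, q X Y (J Z) W = - q (J X) Y Z W.
Hypothesis qJ4 : forall X Y Z W, q X Y Z (J W) = - q (J X) Y Z W.
Hypothesis bianchi : forall X Y Z W,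
  Om X Y Z W + Om Y Z X W + Om Z X Y W =
    N X Y Z W + N Y Z X W + N Z X Y W + q X Y Z W + q Y Z X W + q Z X Y W.

(* In complex terms: if X, Y have the same type, the Bianchi identity gives
   Om(X, Y)Z = (nabla_Z tau)(X, Y) for Z of the opposite type, and the
   components with Z of the same type follow by skew-symmetry.  The eight
   instances below implement this type projection. *)
Let bianchi_opposite X Y Z W :
  Om X Y Z W - Om (J X) (J Y) Z W + Om (J X) Y (J Z) W + Om X (J Y) (J Z) W =
  2 * (N Z X Y W + N (J Z) (J X) Y W).
Proof.
move: (bianchi X Y Z W) (bianchi (J X) (J Y) Z W) (bianchi (J X) Y (J Z) W)
  (bianchi X (J Y) (J Z) W) (bianchi X Y (J Z) (J W))
  (bianchi (J X) (J Y) (J Z) (J W)) (bianchi (J X) Y Z (J W))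
  (bianchi X (J Y) Z (J W)).
rewrite !(OJ, NJ2, NJ3, qJ4, qJ3, qJ2, JJ, ON1, ON3, NN1, NN2, qN); lra.
Qed.

(** Exchanging Z and W in [bianchi_opposite] changes the sign of the two terms wanted here, while
    the two mixed terms are symmetric by [Oskew3] and [OJ]; the difference of both versions isolates
    the former. *)
Lemma curvature_anti_part X Y Z W :
  Om X Y Z W - Om (J X) (J Y) Z W =
  N Z X Y W + N (J Z) (J X) Y W - N W X Y Z - N (J W) (J X) Y Z.
Proof.
move: (bianchi_opposite X Y Z W) (bianchi_opposite X Y W Z).
rewrite !(Oskew3 _ _ W Z) !(Oskew3 _ _ (J W) Z) !OJ.
lra.
Qed.

End CurvatureAntiPart.

(** * Linear forms and metric traces *)

Section LinearForms.
Variables (R : realFieldType) (m : nat).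
Implicit Types (f h : 'rV[R]_m -> R) (s : 'rV[R]_m -> 'rV[R]_m).

(** Linearity as expansion in the standard basis, the form in which it is mostly used: to compare
    multilinear functions on basis vectors, and to turn [J] in a slot into a sum over a row of its
    matrix. *)
Definition linear_form f := forall X, f X = \sum_i X 0 i * f (delta_mx 0 i).
Definition linear_op s := forall X, s X = \sum_i X 0 i *: s (delta_mx 0 i).

Lemma lin_sum f : linear_form f -> forall (I : finType) (c : I -> R) (v : I -> 'rV[R]_m),
  f (\sum_i c i *: v i) = \sum_i c i * f (v i).
Proof.
move=> lf I c v; rewrite lf.
under eq_bigr => j _ do rewrite summxE mulr_suml.
rewrite exchange_big; apply: eq_bigr => i _ /=.
rewrite (lf (v i)) mulr_sumr; apply: eq_bigr => j _.
by rewrite mxE mulrA.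
Qed.

Lemma linN f : linear_form f -> forall X, f (- X) = - f X.
Proof.
move=> lf X; rewrite lf (lf X) -sumrN; apply: eq_bigr => i _.
by rewrite mxE mulNr.
Qed.

Lemma lin_ext f h : linear_form f -> linear_form h ->
  (forall i, f (delta_mx 0 i) = h (delta_mx 0 i)) -> f =1 h.
Proof. by move=> lf lh fh X; rewrite lf lh; apply: eq_bigr => i _; rewrite fh. Qed.

Lemma lin_comp f s : linear_form f -> linear_op s -> linear_form (f \o s).
Proof. by move=> lf ls X; rewrite /= (ls X) (lin_sum lf). Qed.

Lemma linv_mul (A : 'M[R]_m) : linear_op (mulmx^~ A).
Proof.
move=> X; rewrite {1}(row_sum_delta X) mulmx_suml.
by apply: eq_bigr => i _; rewrite scalemxAl.
Qed.

Lemma lin_opp f : linear_form f -> linear_form (fun X => - f X).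
Proof.
move=> lf X; rewrite lf -sumrN; apply: eq_bigr => i _.
by rewrite mulrN.
Qed.

Lemma lin_add f h : linear_form f -> linear_form h -> linear_form (fun X => f X + h X).
Proof.
move=> lf lh X; rewrite lf lh -big_split; apply: eq_bigr => i _.
by rewrite mulrDr.
Qed.

End LinearForms.

Section Trace.
Variables (R : realFieldType) (m : nat) (gi Jm : 'M[R]_m).
Local Notation V := 'rV[R]_m.
Local Notation J X := (X *m Jm).
Implicit Types F : V -> V -> R.

Definition mtrace F :=
  \sum_a \sum_l gi a l * F (delta_mx 0 a) (delta_mx 0 l).

Lemma eq_mtrace F F' : F =2 F' -> mtrace F = mtrace F'.
Proof.
by move=> FF'; apply: eq_bigr => a _; apply: eq_bigr => l _; rewrite FF'.
Qed.

Lemma mtraceD F F' : mtrace (fun z w => F z w + F' z w) = mtrace F + mtrace F'.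
Proof.
rewrite -big_split; apply: eq_bigr => a _; rewrite -big_split.
by apply: eq_bigr => l _; rewrite mulrDr.
Qed.

Lemma mtraceN F : mtrace (fun z w => - F z w) = - mtrace F.
Proof.
rewrite -sumrN; apply: eq_bigr => a _; rewrite -sumrN.
by apply: eq_bigr => l _; rewrite mulrN.
Qed.

Lemma mtraceB F F' : mtrace (fun z w => F z w - F' z w) = mtrace F - mtrace F'.
Proof. by rewrite mtraceD mtraceN. Qed.

Hypothesis gi_sym : gi^T = gi.

Lemma mtraceC F : mtrace (fun z w => F w z) = mtrace F.
Proof.
rewrite /mtrace exchange_big; apply: eq_bigr => a _; apply: eq_bigr => l _ /=.
by rewrite -[in LHS]gi_sym mxE.
Qed.

Hypothesis JJ : Jm *m Jm = - 1%:M.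
Hypothesis giJ : Jm^T *m gi = - (gi *m Jm).

(** [giJ] says that [J] is skew for the inverse metric. Expanding the slot that carries [J] makes
    the two traces contractions of F with [Jm^T *m gi] and [gi *m Jm]. *)
Lemma mtraceJ F : (forall w, linear_form (F^~ w)) -> (forall z, linear_form (F z)) ->
  mtrace (fun z w => F (J z) w) = - mtrace (fun z w => F z (J w)).
Proof.
move=> lF1 lF2; pose Fm a l := F (delta_mx 0 a) (delta_mx 0 l).
have -> : mtrace (fun z w => F (J z) w) =
    \sum_a \sum_l (Jm^T *m gi) a l * Fm a l.
  rewrite /mtrace exchange_big /=.
  under eq_bigr => l _ do under eq_bigr => a _ do
    rewrite (lF1 _ (_ *m Jm)) mulr_sumr.
  under eq_bigr do rewrite exchange_big /=.
  rewrite exchange_big; apply: eq_bigr => b _; apply: eq_bigr => l _ /=.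
  rewrite mxE mulr_suml; apply: eq_bigr => a _.
  by rewrite -rowE !mxE /Fm mulrA (mulrC (gi _ _)).
have -> : mtrace (fun z w => F z (J w)) =
    \sum_a \sum_l (gi *m Jm) a l * Fm a l.
  apply: eq_bigr => a _.
  under eq_bigr => l _ do rewrite (lF2 _ (_ *m Jm)) mulr_sumr.
  rewrite exchange_big; apply: eq_bigr => b _ /=.
  rewrite mxE mulr_suml; apply: eq_bigr => l _.
  by rewrite -rowE !mxE /Fm mulrA.
rewrite giJ -sumrN; apply: eq_bigr => a _; rewrite -sumrN.
by apply: eq_bigr => l _; rewrite mxE mulNr.
Qed.

Lemma mulJJ (X : V) : J (J X) = - X.
Proof. by rewrite -mulmxA JJ mulmxN mulmx1. Qed.

Lemma mtraceJJ F : (forall w, linear_form (F^~ w)) -> (forall z, linear_form (F z)) ->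
  mtrace (fun z w => F (J z) (J w)) = mtrace F.
Proof.
move=> lF1 lF2.
rewrite (@mtraceJ (fun z w => F z (J w))).
- rewrite -mtraceN; apply: eq_mtrace => z w.
  by rewrite mulJJ (linN (lF2 z)) opprK.
- by move=> w; apply: lF1.
- by move=> z; apply: (lin_comp (lF2 z)); apply: linv_mul.
Qed.

(** By [mtraceJJ] a trace sees only the [J]-invariant part. This disposes of every trace over two
    slots of the torsion, or of the torsion slots of its derivative. *)
Lemma mtrace_anti F : (forall w, linear_form (F^~ w)) -> (forall z, linear_form (F z)) ->
  (forall z w, F (J z) (J w) = - F z w) -> mtrace F = 0.
Proof.
move=> lF1 lF2 FJ; have := mtraceJJ lF1 lF2.
rewrite (eq_mtrace FJ) mtraceN; lra.
Qed.

End Trace.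

(** * Traces of the curvature at a point *)

Section PointwiseForms.
Variables (R : realFieldType) (m : nat) (gi Jm : 'M[R]_m).
Local Notation V := 'rV[R]_m.
Variables (tau K : V -> V -> V) (T : V -> V -> V -> R).
Variables N Om : V -> V -> V -> V -> R.

(** The contraction om^cd Om_abcd: since om^cd = J_s^c g^ds, it is a metric trace with [J] applied
    in the third slot. *)
Definition P_form X Y := mtrace gi (fun z w => Om X Y (z *m Jm) w).

(* The Ricci tensor of the Levi-Civita connection nabla + K, where nabla is the
   Chern connection, with lowered torsion T, curvature Om and N = nabla T. *)
Definition ricci_form X Y :=
  mtrace gi (fun z w => Om z X Y w + N z Y w X - N X Y w z
    + T Y w (tau z X) + T (K X Y) w z - T (K z Y) w X).

End PointwiseForms.

Section PointwiseIdentity.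
Variables (R : realFieldType) (m : nat) (gi Jm : 'M[R]_m).
Local Notation V := 'rV[R]_m.
Local Notation J X := (X *m Jm).
Local Notation tr := (mtrace gi).
Hypothesis gi_sym : gi^T = gi.
Hypothesis JJ : Jm *m Jm = - 1%:M.
Hypothesis giJ : Jm^T *m gi = - (gi *m Jm).

Variables (tau K : V -> V -> V) (T : V -> V -> V -> R).
Variables N Om : V -> V -> V -> V -> R.
Hypothesis tau_lin1 : forall Y, linear_op (tau^~ Y).
Hypothesis K_lin1 : forall Y, linear_op (K^~ Y).
Hypothesis T_lin1 : forall Y Z, linear_form (fun X => T X Y Z).
Hypothesis T_lin2 : forall X Z, linear_form (fun Y => T X Y Z).
Hypothesis T_lin3 : forall X Y, linear_form (T X Y).
Hypothesis N_lin1 : forall X Y Z, linear_form (fun W => N W X Y Z).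
Hypothesis N_lin2 : forall W Y Z, linear_form (fun X => N W X Y Z).
Hypothesis N_lin3 : forall W X Z, linear_form (fun Y => N W X Y Z).
Hypothesis N_lin4 : forall W X Y, linear_form (N W X Y).
Hypothesis O_lin1 : forall Y Z W, linear_form (fun X => Om X Y Z W).
Hypothesis O_lin3 : forall X Y W, linear_form (fun Z => Om X Y Z W).
Hypothesis O_lin4 : forall X Y Z, linear_form (Om X Y Z).

Hypothesis tauJ1 : forall X Y, tau (J X) Y = - J (tau X Y).
Hypothesis tauJ2 : forall X Y, tau X (J Y) = - J (tau X Y).
Hypothesis KJ : forall X Y, K X (J Y) = K (J X) Y.
Hypothesis TJ2 : forall X Y Z, T X (J Y) Z = T (J X) Y Z.
Hypothesis TJ3 : forall X Y Z, T X Y (J Z) = T (J X) Y Z.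

Hypothesis NJ2 : forall W X Y Z, N W X (J Y) Z = N W (J X) Y Z.
Hypothesis NJ3 : forall W X Y Z, N W X Y (J Z) = N W (J X) Y Z.
Hypothesis Nskew : forall W X Y Z, N W X Y Z = - N W Y X Z.
Hypothesis Ncycle : forall W X Y Z, N W X Y Z + N W Y Z X + N W Z X Y = 0.
Hypothesis Oskew3 : forall X Y Z W, Om X Y Z W = - Om X Y W Z.
Hypothesis OJ : forall X Y Z W, Om X Y Z (J W) = - Om X Y (J Z) W.
Hypothesis bianchi : forall X Y Z W,
  Om X Y Z W + Om Y Z X W + Om Z X Y W =
    N X Y Z W + N Y Z X W + N Z X Y W
    + T (tau X Y) Z W + T (tau Y Z) X W + T (tau Z X) Y W.

Let mJJ := mulJJ JJ.

Let TN1 X Y Z : T (- X) Y Z = - T X Y Z. Proof. exact: linN (T_lin1 _ _) X. Qed.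
Let TN3 X Y Z : T X Y (- Z) = - T X Y Z. Proof. exact: linN (T_lin3 _ _) Z. Qed.
Let NN1 W X Y Z : N (- W) X Y Z = - N W X Y Z.
Proof. exact: linN (N_lin1 _ _ _) W. Qed.
Let NN2 W X Y Z : N W (- X) Y Z = - N W X Y Z.
Proof. exact: linN (N_lin2 _ _ _) X. Qed.
Let ON1 X Y Z W : Om (- X) Y Z W = - Om X Y Z W.
Proof. exact: linN (O_lin1 _ _ _) X. Qed.
Let ON3 X Y Z W : Om X Y (- Z) W = - Om X Y Z W.
Proof. exact: linN (O_lin3 _ _ _) Z. Qed.

(** The quadratic terms T(tau(X, Y), Z, W) have the symmetries required of [q] because [tau] is
    [J]-antilinear in either argument, while [J] moves without sign between the slots of [T]. *)
Lemma chern_curvature_anti X Y Z W :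
  Om X Y Z W - Om (J X) (J Y) Z W =
  N Z X Y W + N (J Z) (J X) Y W - N W X Y Z - N (J W) (J X) Y Z.
Proof.
apply: (@curvature_anti_part R V (mulmx^~ Jm) N Om
  (fun X Y Z W => T (tau X Y) Z W)) => //.
- move=> X' Y' Z' W' /=.
  have -> : tau (- X') Y' = - tau X' Y'.
    rewrite (tau_lin1 Y' (- X')) (tau_lin1 Y' X') -sumrN.
    by apply: eq_bigr => i _; rewrite mxE scaleNr.
  by rewrite TN1.
- by move=> *; rewrite tauJ1 tauJ2.
- by move=> *; rewrite TJ2 tauJ1 TN1 opprK.
- by move=> *; rewrite TJ3 tauJ1 TN1 opprK.
Qed.

Let E X Y := tr (fun z w => N z w Y X).

(** Each of the four traced terms of [chern_curvature_anti] equals - t, by the symmetry of the trace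
    and by moving [J] across it; the cyclic identity then splits t into two values of E. *)
Lemma chern_P_anti X Y :
  tr (fun z w => Om X Y (J z) w) - tr (fun z w => Om (J X) (J Y) (J z) w) =
  4 * (E Y (J X) - E (J X) Y).
Proof.
pose t := tr (fun z w => N z (J X) Y w).
have tE : t = E (J X) Y - E Y (J X).
  rewrite -mtraceB; apply: eq_mtrace => z w.
  by have := Ncycle z (J X) Y w; rewrite (Nskew z Y w); lra.
have tJ : tr (fun z w => N (J z) X Y w) = - t.
  rewrite (mtraceJ giJ (F := fun z w => N z X Y w)) //.
  by congr (- _); apply: eq_mtrace => z w; rewrite NJ3.
have -> : tr (fun z w => Om X Y (J z) w) - tr (fun z w => Om (J X) (J Y) (J z) w)
    = tr (fun z w => N (J z) X Y w) - t
      - tr (fun z w => N w (J X) Y z) + tr (fun z w => N (J w) X Y z).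
  rewrite -!mtraceB -mtraceD; apply: eq_mtrace => z w.
  by rewrite chern_curvature_anti !NJ3 !mJJ NN1 NN2 opprK.
rewrite (mtraceC gi_sym (fun z w => N z (J X) Y w)).
rewrite (mtraceC gi_sym (fun z w => N (J z) X Y w)) tJ -/t tE; lra.
Qed.

Local Notation ricci := (ricci_form gi tau K T N Om).
Local Notation P := (P_form gi Jm Om).

Lemma ricci_anti X Y :
  ricci X Y - ricci (J X) (J Y) = - 2 * (E X Y + E Y X).
Proof.
have ricciE U W : ricci U W = tr (fun z w => Om z U W w) - E U W
    + tr (fun z w => T W w (tau z U)) - tr (fun z w => T (K z W) w U).
  rewrite /ricci_form mtraceB !mtraceD mtraceN.
  (* The two terms traced over torsion slots only are anti-invariant in the traced vectors, hence
     zero. *)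
  rewrite (@mtrace_anti _ _ _ _ JJ giJ (fun z w => N U W w z)); last first.
  - by move=> z w; rewrite NJ2 NJ3 mJJ NN2.
  - by move=> z; apply: N_lin3.
  - by move=> w; apply: N_lin4.
  rewrite (@mtrace_anti _ _ _ _ JJ giJ (fun z w => T (K U W) w z)); last first.
  - by move=> z w; rewrite TJ2 TJ3 mJJ TN1.
  - by move=> z; apply: T_lin2.
  - by move=> w; apply: T_lin3.
  rewrite (_ : tr (fun z w => N z W w U) = - E U W); first by lra.
  by rewrite -mtraceN; apply: eq_mtrace => z w; rewrite Nskew.
(* E is anti-invariant, so its term in [ricciE] is doubled; the curvature trace below supplies the
   other E with the same factor. *)
have EJ U W : E (J U) (J W) = - E U W.
  rewrite /E -mtraceN; apply: eq_mtrace => z w.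
  by rewrite NJ3 NJ2 mJJ NN2.
rewrite !ricciE EJ.
have -> : tr (fun z w => T (J Y) w (tau z (J X))) =
    tr (fun z w => T Y w (tau z X)).
  apply: eq_mtrace => z w.
  by rewrite tauJ2 TN3 TJ3 mJJ TN1 opprK.
have -> : tr (fun z w => T (K z (J Y)) w (J X)) = tr (fun z w => T (K z Y) w X).
  rewrite -[RHS](mtraceJJ JJ giJ); first last.
  - by move=> z; apply: T_lin2.
  - by move=> w; apply: (lin_comp (T_lin1 w X)).
  by apply: eq_mtrace => z w; rewrite KJ TJ3 TJ2.
(* [OJ] carries [J] from the third slot to the fourth, and the trace carries it on to the first. The
   difference then has the shape of [chern_curvature_anti] for the pair z, X. *)
have -> : tr (fun z w => Om z (J X) (J Y) w) = tr (fun z w => Om (J z) (J X) Y w).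
  rewrite (mtraceJ giJ (F := fun z w => Om z (J X) Y w)) //.
  by rewrite -mtraceN; apply: eq_mtrace => z w; rewrite OJ opprK.
have QE : tr (fun z w => Om z X Y w) - tr (fun z w => Om (J z) (J X) Y w) =
    - 2 * E Y X.
  rewrite -mtraceB.
  have -> : tr (fun z w => Om z X Y w - Om (J z) (J X) Y w) =
      tr (fun z w => N Y z X w) + tr (fun z w => N (J Y) (J z) X w)
      - E Y X - tr (fun z w => N (J w) (J z) X Y).
    rewrite -mtraceD.
    rewrite (_ : E Y X = tr (fun z w => N w z X Y)); last first.
      by rewrite (mtraceC gi_sym).
    rewrite -!mtraceB; apply: eq_mtrace => z w.
    by rewrite chern_curvature_anti.
  rewrite (@mtrace_anti _ _ _ _ JJ giJ (fun z w => N Y z X w)) //; last first.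
    by move=> z w; rewrite NJ3 mJJ NN2.
  rewrite (@mtrace_anti _ _ _ _ JJ giJ (fun z w => N (J Y) (J z) X w)) //.
  - rewrite (mtraceC gi_sym (fun z w => N (J z) (J w) X Y)).
    by rewrite (mtraceJJ JJ giJ (F := fun z w => N z w X Y)) // /E; lra.
  - by move=> w; apply: (lin_comp (N_lin2 (J Y) X w)); apply: linv_mul.
  - by move=> z w; rewrite NJ3 mJJ NN2.
lra.
Qed.

(** The Ricci part carries no factor because the 2 of the flow equation has cancelled against the
    2^-1 of the anti-invariant part. *)
Lemma flow_identity X Y :
  - (2^-1 * (P X Y - P (J X) (J Y))
     - (ricci (J X) Y - ricci (J (J X)) (J Y))) =
  4 * tr (fun z w => N (J z) w X Y).
Proof.
rewrite [P _ _ - _]chern_P_anti ricci_anti.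
rewrite (mtraceJ giJ (F := fun z w => N z w X Y)) //.
rewrite (_ : tr (fun z w => N z (J w) X Y) = E Y (J X)); first by lra.
by apply: eq_mtrace => z w; rewrite NJ2.
Qed.

End PointwiseIdentity.

(** * Tensors given by components *)

Section Evaluation.
Variables (R : realFieldType) (m : nat).
Local Notation V := 'rV[R]_m.
Local Notation "''e_' i" := (delta_mx 0 i : V) (at level 8, i at level 2).

Definition ev1 (f : 'I_m -> R) (X : V) := \sum_i X 0 i * f i.
Definition ev2 (F : 'I_m -> 'I_m -> R) (X Y : V) := ev1 (fun i => ev1 (F i) Y) X.
Definition ev3 (F : 'I_m -> 'I_m -> 'I_m -> R) (X Y Z : V) :=
  ev1 (fun i => ev2 (F i) Y Z) X.
Definition ev4 (F : 'I_m -> 'I_m -> 'I_m -> 'I_m -> R) (W X Y Z : V) :=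
  ev1 (fun i => ev3 (F i) X Y Z) W.

Lemma ev1_delta f i : ev1 f 'e_i = f i.
Proof.
rewrite /ev1 (bigD1 i) //= mxE !eqxx mul1r big1 ?addr0 // => j /negPf ji.
by rewrite mxE ji mul0r.
Qed.

Lemma ev2_delta F i j : ev2 F 'e_i 'e_j = F i j.
Proof. by rewrite /ev2 !ev1_delta. Qed.

Lemma ev3_delta F i j k : ev3 F 'e_i 'e_j 'e_k = F i j k.
Proof. by rewrite /ev3 ev1_delta ev2_delta. Qed.

Lemma ev4_delta F i j k l : ev4 F 'e_i 'e_j 'e_k 'e_l = F i j k l.
Proof. by rewrite /ev4 ev1_delta ev3_delta. Qed.

Lemma lin_ev1 f : linear_form (ev1 f).
Proof. by move=> X; apply: eq_bigr => i _; rewrite ev1_delta. Qed.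

Lemma lin_ev1_param (h : 'I_m -> V -> R) X :
  (forall i, linear_form (h i)) -> linear_form (fun Y => ev1 (fun i => h i Y) X).
Proof.
move=> lh Y; rewrite /ev1.
under eq_bigr do rewrite lh mulr_sumr.
rewrite exchange_big; apply: eq_bigr => j _ /=; rewrite mulr_sumr.
by apply: eq_bigr => i _; rewrite mulrCA.
Qed.

Lemma lin_ev2_1 F Y : linear_form (fun X => ev2 F X Y). Proof. exact: lin_ev1. Qed.
Lemma lin_ev2_2 F X : linear_form (ev2 F X).
Proof. by apply: (lin_ev1_param (h := fun i => ev1 (F i))) => i; apply: lin_ev1. Qed.
Lemma lin_ev3_1 F Y Z : linear_form (fun X => ev3 F X Y Z). Proof. exact: lin_ev1. Qed.
Lemma lin_ev3_2 F X Z : linear_form (fun Y => ev3 F X Y Z).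
Proof.
by apply: (lin_ev1_param (h := fun i Y => ev2 (F i) Y Z)) => i; apply: lin_ev2_1.
Qed.
Lemma lin_ev3_3 F X Y : linear_form (ev3 F X Y).
Proof. by apply: (lin_ev1_param (h := fun i => ev2 (F i) Y)) => i; apply: lin_ev2_2. Qed.
Lemma lin_ev4_1 F X Y Z : linear_form (fun W => ev4 F W X Y Z). Proof. exact: lin_ev1. Qed.
Lemma lin_ev4_2 F W Y Z : linear_form (fun X => ev4 F W X Y Z).
Proof.
by apply: (lin_ev1_param (h := fun i X => ev3 (F i) X Y Z)) => i; apply: lin_ev3_1.
Qed.
Lemma lin_ev4_3 F W X Z : linear_form (fun Y => ev4 F W X Y Z).
Proof.
by apply: (lin_ev1_param (h := fun i Y => ev3 (F i) X Y Z)) => i; apply: lin_ev3_2.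
Qed.
Lemma lin_ev4_4 F W X Y : linear_form (ev4 F W X Y).
Proof. by apply: (lin_ev1_param (h := fun i => ev3 (F i) X Y)) => i; apply: lin_ev3_3. Qed.

Lemma lin_row f (A : 'M[R]_m) i : linear_form f -> f ('e_i *m A) = \sum_b A i b * f 'e_b.
Proof. by move=> lf; rewrite lf; apply: eq_bigr => b _; rewrite -rowE mxE. Qed.

Lemma lin_mulr f (A : 'M[R]_m) : linear_form f -> linear_form (fun X => f (X *m A)).
Proof. by move=> lf; apply: (lin_comp lf); apply: linv_mul. Qed.

Lemma lin_mtrace (gi : 'M[R]_m) (F : V -> V -> V -> R) :
  (forall z w, linear_form (fun X => F X z w)) -> linear_form (fun X => mtrace gi (F X)).
Proof.
move=> lF X; rewrite /mtrace.
under eq_bigr do under eq_bigr do rewrite lF mulr_sumr.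
under eq_bigr do rewrite exchange_big.
rewrite exchange_big; apply: eq_bigr => i _ /=; rewrite mulr_sumr.
apply: eq_bigr => a _; rewrite mulr_sumr; apply: eq_bigr => l _.
by rewrite mulrCA.
Qed.

Lemma lin2_ext (f h : V -> V -> R) :
  (forall Y, linear_form (f^~ Y)) -> (forall X, linear_form (f X)) ->
  (forall Y, linear_form (h^~ Y)) -> (forall X, linear_form (h X)) ->
  (forall i j, f 'e_i 'e_j = h 'e_i 'e_j) -> forall X Y, f X Y = h X Y.
Proof.
move=> f1 f2 h1 h2 fh X Y.
apply: (lin_ext (f1 Y) (h1 Y)) => i.
exact: (lin_ext (f2 _) (h2 _)).
Qed.

Lemma lin3_ext (f h : V -> V -> V -> R) :
  (forall Y Z, linear_form (fun X => f X Y Z)) -> (forall X Z, linear_form (fun Y => f X Y Z)) ->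
  (forall X Y, linear_form (f X Y)) ->
  (forall Y Z, linear_form (fun X => h X Y Z)) -> (forall X Z, linear_form (fun Y => h X Y Z)) ->
  (forall X Y, linear_form (h X Y)) ->
  (forall i j k, f 'e_i 'e_j 'e_k = h 'e_i 'e_j 'e_k) ->
  forall X Y Z, f X Y Z = h X Y Z.
Proof.
move=> f1 f2 f3 h1 h2 h3 fh X Y Z.
apply: (lin_ext (f1 Y Z) (h1 Y Z)) => i.
exact: (lin2_ext (f2 _) (f3 _) (h2 _) (h3 _)).
Qed.

Lemma lin4_ext (f h : V -> V -> V -> V -> R) :
  (forall X Y Z, linear_form (fun W => f W X Y Z)) ->
  (forall W Y Z, linear_form (fun X => f W X Y Z)) ->
  (forall W X Z, linear_form (fun Y => f W X Y Z)) -> (forall W X Y, linear_form (f W X Y)) ->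
  (forall X Y Z, linear_form (fun W => h W X Y Z)) ->
  (forall W Y Z, linear_form (fun X => h W X Y Z)) ->
  (forall W X Z, linear_form (fun Y => h W X Y Z)) -> (forall W X Y, linear_form (h W X Y)) ->
  (forall i j k l, f 'e_i 'e_j 'e_k 'e_l = h 'e_i 'e_j 'e_k 'e_l) ->
  forall W X Y Z, f W X Y Z = h W X Y Z.
Proof.
move=> f1 f2 f3 f4 h1 h2 h3 h4 fh W X Y Z.
apply: (lin_ext (f1 X Y Z) (h1 X Y Z)) => i.
exact: (lin3_ext (f2 _) (f3 _) (f4 _) (h2 _) (h3 _) (h4 _)).
Qed.

(** The vector representing f for the metric with inverse matrix [gi]; see [sharpP] and
    [sharp_unique]. *)
Definition sharp (gi : 'M[R]_m) (f : V -> R) : V :=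
  \row_k \sum_l f 'e_l * gi l k.

Lemma linv_sharp (gi : 'M[R]_m) (F : V -> V -> R) :
  (forall Z, linear_form (F^~ Z)) -> linear_op (fun X => sharp gi (F X)).
Proof.
move=> lF X; apply/rowP => k; rewrite mxE summxE.
under eq_bigr do rewrite lF mulr_suml.
rewrite exchange_big; apply: eq_bigr => i _ /=; rewrite !mxE mulr_sumr.
by apply: eq_bigr => l _; rewrite mulrA.
Qed.

Definition inner (gm : 'M[R]_m) : V -> V -> R := ev2 (fun i j => gm i j).

Lemma sharpP (gm gi : 'M[R]_m) f : gi *m gm = 1%:M -> linear_form f ->
  inner gm (sharp gi f) =1 f.
Proof.
move=> gV lf; apply: lin_ext => //; first exact: lin_ev2_2.
move=> j; rewrite /inner /ev2 /ev1.
under eq_bigr => i _ do rewrite -/(ev1 (fun j => gm i j) _) ev1_delta mxE mulr_suml.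
rewrite exchange_big /= -[RHS](ev1_delta (fun j => f 'e_j)).
apply: eq_bigr => l _.
rewrite (_ : 'e_j 0 l = (gi *m gm) l j); last first.
  by rewrite gV !mxE eqxx eq_sym.
rewrite mxE mulr_suml; apply: eq_bigr => i _.
by rewrite -mulrA mulrC.
Qed.

Lemma sharp_unique (gm gi : 'M[R]_m) f X : gm *m gi = 1%:M ->
  inner gm X =1 f -> X = sharp gi f.
Proof.
move=> gV fX; rewrite -[LHS]mulmx1 -gV mulmxA; apply/rowP => k; rewrite !mxE.
apply: eq_bigr => l _; rewrite -fX mxE; congr (_ * _).
by apply: eq_bigr => i _; rewrite ev1_delta.
Qed.

End Evaluation.

(** * Partial derivatives and curvature in a chart *)

Section PartialDerivatives.
Variables (R : realType) (m : nat).
Local Notation V := 'rV[R]_m.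
Implicit Types (f h : V -> R) (U : set V) (x : V) (i : 'I_m).

Lemma eq_pd U f h x i : open U -> U x -> (forall y, U y -> f y = h y) -> pd i f x = pd i h x.
Proof.
move=> oU Ux fh; apply: near_eq_derive.
by near=> y; apply: fh; near: y; exact: open_nbhs_nbhs.
Unshelve. all: by end_near. Qed.

Lemma smooth_derivable U f x v : smooth_on U (f : V -> R^o) -> U x ->
  derivable f x v.
Proof. by move=> sf Ux; have [_] := sf [::] x Ux; apply. Qed.

Lemma smooth_derivable_pd U f x i v : smooth_on U (f : V -> R^o) -> U x ->
  derivable (pd i f) x v.
Proof. by move=> sf Ux; have [_] := sf [:: delta_mx 0 i] x Ux; apply. Qed.

Lemma pdD f h x i : derivable f x (delta_mx 0 i) -> derivable h x (delta_mx 0 i) ->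
  pd i (fun y => f y + h y) x = pd i f x + pd i h x.
Proof. exact: deriveD. Qed.

Lemma pd_sumM (F H : 'I_m -> V -> R) x i :
  (forall b, derivable (F b) x (delta_mx 0 i)) ->
  (forall b, derivable (H b) x (delta_mx 0 i)) ->
  pd i (fun y => \sum_b F b y * H b y) x =
    \sum_b (pd i (F b) x * H b x + F b x * pd i (H b) x).
Proof.
move=> dF dH; rewrite /pd.
have -> : (fun y => \sum_b F b y * H b y) = \sum_b (F b * H b).
  by apply/funext => y; rewrite fct_sumE.
rewrite derive_sum; last by move=> b; apply: derivableM.
apply: eq_bigr => b _; rewrite (deriveM (dF b) (dH b)).
by rewrite addrC [X in X + _]mulrC.
Qed.

Lemma derivable_sumM (F H : 'I_m -> V -> R) x v :
  (forall b, derivable (F b) x v) -> (forall b, derivable (H b) x v) ->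
  derivable (fun y => \sum_b F b y * H b y) x v.
Proof.
move=> dF dH.
have -> : (fun y => \sum_b F b y * H b y) = \sum_b (F b * H b).
  by apply/funext => y; rewrite fct_sumE.
by apply: derivable_sum => b; apply: derivableM.
Qed.

Lemma smooth_cst U (k : R) : smooth_on U (fun _ : V => k : R^o).
Proof.
move=> vs x Ux /=.
suff [l ->] : exists l : R^o, foldr (fun v f => 'D_v f) (fun _ : V => k : R^o) vs = cst l.
  by split; [exact: cst_continuous | move=> v; exact: derivable_cst].
elim: vs => [|v vs [l /= ->]]; first by exists k.
by exists 0; apply/funext => y; rewrite derive_cst.
Qed.

End PartialDerivatives.

(* Hides sums and derivatives behind variables, as ring and lra would try to
   unify them up to conversion. *)
Ltac abstract_atoms :=
  repeat match goal with
  | |- context [@bigop.body ?A ?I ?i ?r ?b] =>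
      let p := fresh in move: (@bigop.body A I i r b) => p
  end;
  repeat match goal with
  | |- context [pd ?i ?f ?x] => let p := fresh in move: (pd i f x) => p
  end.

(** The classical coordinate formula. [is_curvature] fixes the curvature only through its action on
    fields, and [curvatureE] identifies it with this expression. *)
Definition curvature_of (R : realType) (m : nat) (G : comp3 R m) : comp4 R m :=
  fun x a b d k => pd a (fun y => G y b d k) x - pd b (fun y => G y a d k) x
    + \sum_e (G x a e k * G x b d e - G x b e k * G x a d e).

Section Curvature.
Variables (R : realType) (m : nat) (U : set 'rV[R]_m) (G : comp3 R m).
Variable Om : comp4 R m.
Hypothesis oU : open U.
Hypothesis G_smooth : forall i j k, smooth_on U (fun x => G x i j k : R^o).
Hypothesis OmP : is_curvature U G Om.

Let dG x i j k v : U x -> derivable (fun y => G y i j k) x v.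
Proof. exact: smooth_derivable. Qed.

(** The connection terms in the index of differentiation antisymmetrise to the torsion term of
    [is_curvature] and cancel it. The commutator of partial derivatives is kept, as its vanishing is
    derived only in [pd_pdC]. *)
Lemma curvature_commutator (X : comp1 R m) x a b k :
  (forall k, smooth_on U (fun x => X x k : R^o)) -> U x ->
  pd a (pd b (fun y => X y k)) x - pd b (pd a (fun y => X y k)) x
    + \sum_d curvature_of G x a b d k * X x d = \sum_d Om x a b d k * X x d.
Proof.
move=> sX Ux; have dX y c v : U y -> derivable (fun y => X y c) y v.
  by move=> Uy; apply: smooth_derivable Uy.
have pdcov c e : pd c (fun y => cov10 G X y e k) x =
    pd c (pd e (fun y => X y k)) x
    + (\sum_d pd c (fun y => G y e d k) x * X x d
    + \sum_d G x e d k * pd c (fun y => X y d) x).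
  have dG' d : derivable (fun y => G y e d k) x (delta_mx 0 c) by exact: dG.
  have dX' d : derivable (fun y => X y d) x (delta_mx 0 c) by exact: dX.
  rewrite pdD.
  - by rewrite (pd_sumM dG' dX') big_split.
  - exact: smooth_derivable_pd.
  - exact: derivable_sumM dG' dX'.
have /eqP := OmP sX Ux a b k; rewrite eq_sym subr_eq => /eqP ->.
rewrite /cov11 !pdcov /torsion.
have -> : \sum_e (G x a b e - G x b a e) * cov10 G X x e k =
    \sum_e G x a b e * cov10 G X x e k - \sum_e G x b a e * cov10 G X x e k.
  by rewrite -sumrB; apply: eq_bigr => e _; rewrite mulrBl.
have GG c f : \sum_e G x c e k * cov10 G X x f e =
    \sum_e G x c e k * pd f (fun y => X y e) x
    + \sum_d (\sum_e G x c e k * G x f d e) * X x d.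
  rewrite /cov10; under eq_bigr do rewrite mulrDr.
  rewrite big_split /=; congr (_ + _).
  under eq_bigr do rewrite mulr_sumr.
  rewrite exchange_big; apply: eq_bigr => d _ /=; rewrite mulr_suml.
  by apply: eq_bigr => e _; rewrite mulrA.
rewrite !GG.
have -> : \sum_d curvature_of G x a b d k * X x d =
    \sum_d (pd a (fun y => G y b d k) x * X x d)
    - \sum_d (pd b (fun y => G y a d k) x * X x d)
    + (\sum_d (\sum_e G x a e k * G x b d e) * X x d
    - \sum_d (\sum_e G x b e k * G x a d e) * X x d).
  rewrite -!sumrB -big_split; apply: eq_bigr => d _ /=.
  by rewrite /curvature_of sumrB; ring.
abstract_atoms; ring.
Qed.

(** Tested on a coordinate field: its components are constant, so no derivative remains and both
    contractions reduce to their term of index d. *)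
Lemma curvatureE x a b d k : U x -> Om x a b d k = curvature_of G x a b d k.
Proof.
move=> Ux; pose X : comp1 R m := fun _ c => (c == d)%:R.
have /(_ X x a b k) := curvature_commutator.
have pick F : \sum_c F c * X x c = F d.
  rewrite (bigD1 d) //= /X eqxx mulr1 big1 ?addr0 // => c /negPf ->.
  by rewrite mulr0.
rewrite !pick => <- //; last by move=> c; apply: smooth_cst.
rewrite /pd /X.
have c0 c : (fun y : 'rV[R]_m => 'D_(delta_mx 0 c) (fun _ => (k == d)%:R : R) y)
    = cst 0 by apply/funext => y; rewrite derive_cst.
by rewrite !c0 !derive_cst; ring.
Qed.

(* Instead of Schwarz's theorem: once curvatureE is known from constant fields,
   the defining identity of the curvature leaves only the commutator of the
   partial derivatives. *)
Lemma pd_pdC (f : 'rV[R]_m -> R) x a b : smooth_on U (f : _ -> R^o) -> U x ->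
  pd a (pd b f) x = pd b (pd a f) x.
Proof.
move=> sf Ux.
have := @curvature_commutator (fun y _ => f y) x a b a (fun=> sf) Ux.
have -> : \sum_d Om x a b d a * f x = \sum_d curvature_of G x a b d a * f x.
  by apply: eq_bigr => d _; rewrite curvatureE.
abstract_atoms; lra.
Qed.

(** Meant for [om], whose components are such sums of products of [J] and [g]. Only the commutation
    is deduced from the factors, which avoids proving products smooth to all orders. *)
Lemma pd_pdC_sumM (F H : 'I_m -> 'rV[R]_m -> R) x a b :
  (forall e, smooth_on U (F e : _ -> R^o)) ->
  (forall e, smooth_on U (H e : _ -> R^o)) -> U x ->
  pd a (pd b (fun y => \sum_e F e y * H e y)) x =
  pd b (pd a (fun y => \sum_e F e y * H e y)) x.
Proof.
move=> sF sH Ux.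
have dF y e v : U y -> derivable (F e) y v by exact: smooth_derivable.
have dH y e v : U y -> derivable (H e) y v by exact: smooth_derivable.
have ddF e c v : derivable (pd c (F e)) x v by exact: smooth_derivable_pd Ux.
have ddH e c v : derivable (pd c (H e)) x v by exact: smooth_derivable_pd Ux.
have pd2 c d : pd c (pd d (fun y => \sum_e F e y * H e y)) x =
    \sum_e pd c (pd d (F e)) x * H e x + \sum_e pd d (F e) x * pd c (H e) x
    + (\sum_e pd c (F e) x * pd d (H e) x + \sum_e F e x * pd c (pd d (H e)) x).
  have E y : U y -> pd d (fun y => \sum_e F e y * H e y) y =
      \sum_e pd d (F e) y * H e y + \sum_e F e y * pd d (H e) y.
    move=> Uy; rewrite (pd_sumM (fun e => dF y e _ Uy) (fun e => dH y e _ Uy)).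
    by rewrite big_split.
  have dF' e v : derivable (F e) x v by exact: dF.
  have dH' e v : derivable (H e) x v by exact: dH.
  rewrite (eq_pd _ oU Ux E) pdD.
  - rewrite (pd_sumM (fun e => ddF e d _) (dH'^~ _)).
    by rewrite (pd_sumM (dF'^~ _) (fun e => ddH e d _)) !big_split.
  - exact: (derivable_sumM (fun e => ddF e d _) (dH'^~ _)).
  - exact: (derivable_sumM (dF'^~ _) (fun e => ddH e d _)).
have cF e := pd_pdC a b (sF e) Ux; have cH e := pd_pdC a b (sH e) Ux.
rewrite (pd2 a b) (pd2 b a).
(* The two sums of products of first derivatives trade places; the outer sums commute factor by
   factor. *)
have swap (p p' q r s s' : R) : p = p' -> s = s' ->
    p + q + (r + s) = p' + r + (q + s') by move=> -> ->; rewrite addrACA.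
by apply: swap; apply: eq_bigr => e _; rewrite ?cF ?cH.
Qed.

(** The integrability condition of nabla B = 0: differentiating the equation and substituting it
    back gives the second derivatives of B. The double sums with one connection coefficient on each
    index of B are symmetric in the two directions and drop out. Applied to [g] and [om], it yields
    [OmL_skew3] and [OmL_J]. *)
Lemma parallel_curvature (B : comp2 R m) x a b i j :
  (forall y i j v, U y -> derivable (fun y => B y i j) y v) ->
  pd a (pd b (fun y => B y i j)) x = pd b (pd a (fun y => B y i j)) x ->
  (forall y, U y -> forall a i j, cov02 G B y a i j = 0) -> U x ->
  \sum_e Om x a b i e * B x e j + \sum_e Om x a b j e * B x i e = 0.
Proof.
move=> dB + B0 Ux.
have pdB y c k l : U y -> pd c (fun y => B y k l) y =
    \sum_e G y c k e * B y e l + \sum_e G y c l e * B y k e.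
  by move=> Uy; have := B0 y Uy c k l; rewrite /cov02; lra.
have pd2 c f : pd c (pd f (fun y => B y i j)) x =
    \sum_e (pd c (fun y => G y f i e) x + \sum_h G x f i h * G x c h e) * B x e j
    + \sum_e (pd c (fun y => G y f j e) x + \sum_h G x f j h * G x c h e) * B x i e
    + (\sum_e \sum_h G x f i e * G x c j h * B x e h
       + \sum_e \sum_h G x c i e * G x f j h * B x e h).
  rewrite (eq_pd _ oU Ux (fun y => pdB y f i j)).
  have dG' k l e : derivable (fun y => G y k l e) x (delta_mx 0 c) by exact: dG.
  have dB' k l : derivable (fun y => B y k l) x (delta_mx 0 c) by exact: dB.
  rewrite pdD.
  - rewrite (pd_sumM (dG' f i) (dB'^~ j)) (pd_sumM (dG' f j) (dB' i)).
    under eq_bigr do rewrite pdB // mulrDr.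
    under [X in _ + X]eq_bigr do rewrite pdB // mulrDr.
    under [X in _ = X + _ + _]eq_bigr do rewrite mulrDl.
    under [X in _ = _ + X + _]eq_bigr do rewrite mulrDl.
    rewrite !big_split /=.
    have E1 k l : \sum_e G x f k e * (\sum_h G x c e h * B x h l) =
        \sum_e (\sum_h G x f k h * G x c h e) * B x e l.
      under eq_bigr do rewrite mulr_sumr.
      rewrite exchange_big; apply: eq_bigr => e _ /=; rewrite mulr_suml.
      by apply: eq_bigr => h _; rewrite mulrA.
    have E2 k l : \sum_e G x f l e * (\sum_h G x c e h * B x k h) =
        \sum_e (\sum_h G x f l h * G x c h e) * B x k e.
      under eq_bigr do rewrite mulr_sumr.
      rewrite exchange_big; apply: eq_bigr => e _ /=; rewrite mulr_suml.
      by apply: eq_bigr => h _; rewrite mulrA.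
    have E3 : \sum_e G x f i e * (\sum_h G x c j h * B x e h) =
        \sum_e \sum_h G x f i e * G x c j h * B x e h.
      apply: eq_bigr => e _; rewrite mulr_sumr.
      by apply: eq_bigr => h _; rewrite mulrA.
    have E4 : \sum_e G x f j e * (\sum_h G x c i h * B x h e) =
        \sum_e \sum_h G x c i e * G x f j h * B x e h.
      under eq_bigr do rewrite mulr_sumr.
      rewrite exchange_big; apply: eq_bigr => e _ /=.
      by apply: eq_bigr => h _; rewrite mulrA (mulrC (G x f j h)).
    rewrite E1 E2 E3 E4; abstract_atoms; ring.
  - exact: (derivable_sumM (dG' f i) (dB'^~ j)).
  - exact: (derivable_sumM (dG' f j) (dB' i)).
rewrite (pd2 a b) (pd2 b a) => pdE.
have -> : \sum_e Om x a b i e * B x e j = \sum_e curvature_of G x a b i e * B x e j.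
  by apply: eq_bigr => e _; rewrite curvatureE.
have -> : \sum_e Om x a b j e * B x i e = \sum_e curvature_of G x a b j e * B x i e.
  by apply: eq_bigr => e _; rewrite curvatureE.
have split l (C : 'I_m -> R) : \sum_e curvature_of G x a b l e * C e =
    \sum_e (pd a (fun y => G y b l e) x + \sum_h G x b l h * G x a h e) * C e
    - \sum_e (pd b (fun y => G y a l e) x + \sum_h G x a l h * G x b h e) * C e.
  rewrite -sumrB; apply: eq_bigr => e _; rewrite /curvature_of sumrB.
  under eq_bigr do rewrite mulrC.
  under [X in _ + (_ - X)]eq_bigr do rewrite mulrC.
  abstract_atoms; ring.
rewrite !split; move: pdE; abstract_atoms; lra.
Qed.

End Curvature.

(** The final formula differentiates the torsion with its upper index, but the cyclic and
    [J]-symmetries involve all three slots of the lowered torsion. *)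
Definition cov03 (R : realType) (m : nat) (G : comp3 R m) (T : comp3 R m) :
    comp4 R m := fun x a i j k =>
  pd a (fun y => T y i j k) x
  - \sum_b G x a i b * T x b j k - \sum_b G x a j b * T x i b k
  - \sum_b G x a k b * T x i j b.

(** * Covariant derivatives of contractions with parallel tensors *)

Section Leibniz.
Variables (R : realType) (m : nat) (U : set 'rV[R]_m) (G : comp3 R m).
Hypothesis oU : open U.
Implicit Types (T : comp3 R m) (x : 'rV[R]_m) (a i j k : 'I_m).

Lemma exchange_sumM (A B : 'I_m -> R) (C : 'I_m -> 'I_m -> R) :
  \sum_e A e * (\sum_b B b * C e b) = \sum_b B b * (\sum_e A e * C e b).
Proof.
under eq_bigr do rewrite mulr_sumr.
rewrite exchange_big; apply: eq_bigr => b _ /=; rewrite mulr_sumr.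
by apply: eq_bigr => e _; rewrite mulrCA.
Qed.

(** nabla J = 0 solved for the partial derivative. The first sum is what the covariant derivative of
    the contraction subtracts for the index i, the second is the connection term for the contracted
    index of C. *)
Lemma sum_parallelJ (J : comp2 R m) x a i (C : 'I_m -> R) :
  (forall b, cov11 G J x a i b = 0) ->
  \sum_b pd a (fun y => J y i b) x * C b =
    \sum_e G x a i e * (\sum_b J x e b * C b)
    - \sum_b J x i b * (\sum_e G x a b e * C e).
Proof.
move=> J0.
have pdJ b : pd a (fun y => J y i b) x =
    \sum_e G x a i e * J x e b - \sum_e G x a e b * J x i e.
  by have := J0 b; rewrite /cov11; abstract_atoms; lra.
under eq_bigr do rewrite pdJ mulrBl.
rewrite sumrB; congr (_ - _).
  under eq_bigr do rewrite mulr_suml.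
  rewrite exchange_big; apply: eq_bigr => e _ /=; rewrite mulr_sumr.
  by apply: eq_bigr => b _; rewrite mulrA.
under eq_bigr do rewrite mulr_suml.
rewrite exchange_big; apply: eq_bigr => e _ /=; rewrite mulr_sumr.
by apply: eq_bigr => b _; rewrite mulrCA mulrA.
Qed.

Lemma cov02_contract (J T : comp2 R m) x a i j :
  (forall i j v, derivable (fun y => J y i j) x v) ->
  (forall i j v, derivable (fun y => T y i j) x v) ->
  (forall i b, cov11 G J x a i b = 0) ->
  cov02 G (fun y i j => \sum_b J y i b * T y b j) x a i j =
    \sum_b J x i b * cov02 G T x a b j.
Proof.
move=> dJ dT J0; rewrite /cov02 /=.
rewrite (pd_sumM (fun b => dJ i b _) (fun b => dT b j _)) big_split /=.
rewrite sum_parallelJ // (exchange_sumM _ _ (fun e b => T x b e)).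
under [RHS]eq_bigr do rewrite !mulrBr.
rewrite !sumrB; abstract_atoms; ring.
Qed.

(** Only a contraction in the first slot is treated; the other slots are reached through
    [cov03_swap12] and [cov03_rot]. *)
Lemma cov03_contract (J : comp2 R m) T x a i j k :
  (forall i j v, derivable (fun y => J y i j) x v) ->
  (forall i j k v, derivable (fun y => T y i j k) x v) ->
  (forall i b, cov11 G J x a i b = 0) ->
  cov03 G (fun y i j k => \sum_b J y i b * T y b j k) x a i j k =
    \sum_b J x i b * cov03 G T x a b j k.
Proof.
move=> dJ dT J0; rewrite /cov03 /=.
rewrite (pd_sumM (fun b => dJ i b _) (fun b => dT b j k _)) big_split /=.
rewrite sum_parallelJ //.
rewrite (exchange_sumM _ _ (fun e b => T x b e k)).
rewrite (exchange_sumM _ _ (fun e b => T x b j e)).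
under [RHS]eq_bigr do rewrite !mulrBr.
rewrite !sumrB; abstract_atoms; ring.
Qed.

Definition lower (S : comp3 R m) (g : comp2 R m) : comp3 R m :=
  fun y i j k => \sum_l S y i j l * g y l k.

Lemma cov03_lower (S : comp3 R m) (g : comp2 R m) x a i j k :
  (forall i j v, derivable (fun y => g y i j) x v) ->
  (forall i j k v, derivable (fun y => S y i j k) x v) ->
  (forall i b, cov02 G g x a i b = 0) ->
  cov03 G (lower S g) x a i j k = \sum_l cov12 G S x a i j l * g x l k.
Proof.
move=> dg dS g0; rewrite /cov03 /lower /=.
rewrite (pd_sumM (fun b => dS i j b _) (fun b => dg b k _)) big_split /=.
have pdg b : pd a (fun y => g y b k) x =
    \sum_e G x a b e * g x e k + \sum_e G x a k e * g x b e.
  by have := g0 b k; rewrite /cov02; abstract_atoms; lra.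
have -> : \sum_b S x i j b * pd a (fun y => g y b k) x =
    \sum_l (\sum_b G x a b l * S x i j b) * g x l k
    + \sum_e G x a k e * (\sum_l S x i j l * g x l e).
  under eq_bigr do rewrite pdg mulrDr.
  rewrite big_split /=; congr (_ + _).
    under eq_bigr do rewrite mulr_sumr.
    rewrite exchange_big; apply: eq_bigr => e _ /=; rewrite mulr_suml.
    by apply: eq_bigr => b _; rewrite mulrCA mulrA.
  by rewrite exchange_sumM.
under [RHS]eq_bigr do rewrite /cov12 mulrDl !mulrBl.
rewrite !(big_split, sumrN) /=.
have E (C : 'I_m -> R) (Q : 'I_m -> 'I_m -> R) :
    \sum_b C b * (\sum_l Q b l * g x l k) = \sum_l (\sum_b C b * Q b l) * g x l k.
  under eq_bigr do rewrite mulr_sumr.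
  rewrite exchange_big; apply: eq_bigr => e _ /=; rewrite mulr_suml.
  by apply: eq_bigr => b _; rewrite mulrA.
rewrite !E; abstract_atoms; ring.
Qed.

Lemma eq_cov02 (T T' : comp2 R m) x a i j : U x ->
  (forall y, U y -> forall i j, T y i j = T' y i j) ->
  cov02 G T x a i j = cov02 G T' x a i j.
Proof.
move=> Ux TT'; rewrite /cov02 (eq_pd a oU Ux (fun y Uy => TT' y Uy i j)).
by congr (_ - _ - _); apply: eq_bigr => b _; rewrite TT'.
Qed.

Lemma eq_cov03 T T' x a i j k : U x ->
  (forall y, U y -> forall i j k, T y i j k = T' y i j k) ->
  cov03 G T x a i j k = cov03 G T' x a i j k.
Proof.
move=> Ux TT'; rewrite /cov03 (eq_pd a oU Ux (fun y Uy => TT' y Uy i j k)).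
by congr (_ - _ - _ - _); apply: eq_bigr => b _; rewrite TT'.
Qed.

Lemma cov03_swap12 T x a i j k :
  cov03 G (fun y i j k => T y j i k) x a i j k = cov03 G T x a j i k.
Proof. by rewrite /cov03 /=; abstract_atoms; ring. Qed.

Lemma cov03_rot T x a i j k :
  cov03 G (fun y i j k => T y j k i) x a i j k = cov03 G T x a j k i.
Proof. by rewrite /cov03 /=; abstract_atoms; ring. Qed.

Lemma cov03D T T' x a i j k :
  (forall i j k v, derivable (fun y => T y i j k) x v) ->
  (forall i j k v, derivable (fun y => T' y i j k) x v) ->
  cov03 G (fun y i j k => T y i j k + T' y i j k) x a i j k =
    cov03 G T x a i j k + cov03 G T' x a i j k.
Proof.
move=> dT dT'; rewrite /cov03 pdD //.
have E (C P Q : 'I_m -> R) : \sum_b C b * (P b + Q b) =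
    \sum_b C b * P b + \sum_b C b * Q b.
  by rewrite -big_split; apply: eq_bigr => b _; rewrite mulrDr.
rewrite !E; abstract_atoms; ring.
Qed.

Lemma cov03_0 x a i j k : cov03 G (fun _ _ _ _ => 0) x a i j k = 0.
Proof.
rewrite /cov03 /pd derive_cst.
by rewrite !big1 ?subr0 // => b _; rewrite mulr0.
Qed.

End Leibniz.

Definition comp_mx (R : realType) (m : nat) (A : comp2 R m) (y : 'rV[R]_m) :
  'M[R]_m := \matrix_(i, j) A y i j.

(** * Almost Kahler structures in a chart *)

Section LocalAlmostKahler.
Variables (R : realType) (m : nat) (U : set 'rV[R]_m).
Variables (g J om : comp2 R m) (G D : comp3 R m) (Om Rm : comp4 R m).
Local Notation V := 'rV[R]_m.
Local Notation "''e_' i" := (delta_mx 0 i : 'rV[R]_m) (at level 8, i at level 2).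
Hypothesis oU : open U.
Hypothesis g_smooth : forall i j, smooth_on U (fun x => g x i j : R^o).
Hypothesis J_smooth : forall i j, smooth_on U (fun x => J x i j : R^o).
Hypothesis G_smooth : forall i j k, smooth_on U (fun x => G x i j k : R^o).
Hypothesis D_smooth : forall i j k, smooth_on U (fun x => D x i j k : R^o).
Hypothesis g_sym : forall y, U y -> forall i j, g y i j = g y j i.
Hypothesis g_pos : forall y, U y -> forall v : 'I_m -> R, (exists i, v i != 0) ->
  0 < \sum_i \sum_j g y i j * v i * v j.
Hypothesis J_square : forall y, U y -> forall i l,
  \sum_k J y i k * J y k l = - (i == l)%:R.
Hypothesis J_isometry : forall y, U y -> forall i j,
  \sum_a \sum_b J y i a * J y j b * g y a b = g y i j.
Hypothesis om_form : forall y, U y -> forall i j,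
  om y i j = \sum_a J y i a * g y j a.
Hypothesis om_closed : forall y, U y -> forall i j k,
  pd i (fun y => om y j k) y + pd j (fun y => om y k i) y
  + pd k (fun y => om y i j) y = 0.
Hypothesis G_om : forall y, U y -> forall a i j, cov02 G om y a i j = 0.
Hypothesis G_J : forall y, U y -> forall a i k, cov11 G J y a i k = 0.
Hypothesis G_torsion : forall y, U y -> forall i j k,
  torsion G y i j k = - \sum_a \sum_b J y i a * J y j b * torsion G y a b k.
Hypothesis D_g : forall y, U y -> forall a i j, cov02 D g y a i j = 0.
Hypothesis D_torsion : forall y, U y -> forall i j k, torsion D y i j k = 0.
Hypothesis Om_curvature : is_curvature U G Om.
Hypothesis Rm_curvature : is_curvature U D Rm.

Let Jm := comp_mx J.
Let gm := comp_mx g.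
Let gi y := invmx (gm y).
Local Notation tau := (torsion G).
Let torsL := lower tau g.
Let torsOm := lower tau om.

Lemma comp_mxE (A : comp2 R m) y i j : comp_mx A y i j = A y i j.
Proof. by rewrite mxE. Qed.

Lemma JmJm y : U y -> Jm y *m Jm y = - 1%:M.
Proof.
move=> Uy; apply/matrixP => i l; rewrite !mxE -(J_square Uy).
by apply: eq_bigr => k _; rewrite !mxE.
Qed.

Lemma gm_sym y : U y -> (gm y)^T = gm y.
Proof. by move=> Uy; apply/matrixP => i j; rewrite !mxE g_sym. Qed.

Lemma gm_unit y : U y -> gm y \in unitmx.
Proof.
move=> Uy; rewrite -row_free_unit; apply/inj_row_free => v vg0.
apply/eqP; apply: contraT => /rV0Pn v0.
have := g_pos Uy v0; rewrite (_ : \sum_i _ = (v *m gm y *m v^T) 0 0).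
  by rewrite vg0 mul0mx mxE ltxx.
rewrite mxE exchange_big; apply: eq_bigr => j _ /=; rewrite !mxE mulr_suml.
by apply: eq_bigr => i _; rewrite mxE (mulrC (v 0 i)).
Qed.

Lemma giE y : U y -> gi y *m gm y = 1%:M. Proof. by move=> /gm_unit/mulVmx. Qed.
Lemma gEi y : U y -> gm y *m gi y = 1%:M. Proof. by move=> /gm_unit/mulmxV. Qed.

Lemma gi_sym y : U y -> (gi y)^T = gi y.
Proof. by move=> Uy; rewrite /gi trmx_inv gm_sym. Qed.

Lemma JgJ y : U y -> Jm y *m gm y *m (Jm y)^T = gm y.
Proof.
move=> Uy; apply/matrixP => i j; rewrite [RHS]mxE -(J_isometry Uy) mxE.
rewrite exchange_big; apply: eq_bigr => b _ /=; rewrite !mxE mulr_suml.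
by apply: eq_bigr => a _; rewrite !mxE mulrAC.
Qed.

Lemma Jg y : U y -> Jm y *m gm y = - (gm y *m (Jm y)^T).
Proof.
move=> Uy; rewrite -{1}(JgJ Uy) !mulmxA (JmJm Uy) !mulNmx mul1mx.
by [].
Qed.

Lemma giJ y : U y -> (Jm y)^T *m gi y = - (gi y *m Jm y).
Proof.
move=> Uy; have /(congr1 (fun A => gi y *m A *m gi y)) := Jg Uy.
rewrite mulmxN mulNmx !mulmxA (giE Uy) mul1mx -!mulmxA (gEi Uy) mulmx1.
by move=> ->; rewrite opprK.
Qed.

Lemma omE y : U y -> comp_mx om y = Jm y *m gm y.
Proof.
move=> Uy; apply/matrixP => i j; rewrite !mxE om_form //.
by apply: eq_bigr => a _; rewrite !mxE g_sym.
Qed.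

Lemma om_skew y i j : U y -> om y i j = - om y j i.
Proof.
move=> Uy; rewrite -!(comp_mxE om) omE // {1}Jg // mxE; congr (- _).
by rewrite -{1}[gm y]gm_sym // -trmx_mul mxE.
Qed.

Lemma lower_torsion_skew (h : comp2 R m) y i j k :
  lower tau h y i j k = - lower tau h y j i k.
Proof.
rewrite /lower -sumrN; apply: eq_bigr => l _.
by rewrite -mulNr /torsion opprB.
Qed.

(** By nabla om = 0 the partial derivatives in d om are connection terms, and their
    antisymmetrisation is the torsion paired with [om]. *)
Lemma torsOm_cycle y i j k : U y -> torsOm y i j k + torsOm y j k i + torsOm y k i j = 0.
Proof.
move=> Uy.
have pd_om a b c : pd a (fun y => om y b c) y =
    \sum_l G y a b l * om y l c - \sum_l G y a c l * om y l b.
  have := G_om Uy a b c; rewrite /cov02.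
  have -> : \sum_l G y a c l * om y b l = - \sum_l G y a c l * om y l b.
    by rewrite -sumrN; apply: eq_bigr => l _; rewrite (om_skew b l Uy) mulrN.
  abstract_atoms; lra.
have torsOmE a b c : torsOm y a b c =
    \sum_l G y a b l * om y l c - \sum_l G y b a l * om y l c.
  by rewrite -sumrB; apply: eq_bigr => l _; rewrite /torsion mulrBl.
have := om_closed Uy i j k; rewrite !pd_om !torsOmE; abstract_atoms; lra.
Qed.

Let T y := ev3 (torsL y).
(** om(tau(X, Y), Z) is the pairing in which closedness of [om] is a cyclic identity; [T_B]
    transfers its symmetries to [T]. *)
Let B y := ev3 (torsOm y).

Lemma B_skew y X Y Z : B y X Y Z = - B y Y X Z.
Proof.
apply: (lin3_ext (f := B y) (h := fun X Y Z => - B y Y X Z)) => *.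
- exact: lin_ev3_1.
- exact: lin_ev3_2.
- exact: lin_ev3_3.
- by apply: lin_opp; apply: lin_ev3_2.
- by apply: lin_opp; apply: lin_ev3_1.
- by apply: lin_opp; apply: lin_ev3_3.
- by rewrite /B !ev3_delta /torsOm lower_torsion_skew.
Qed.

Lemma B_cycle y X Y Z : U y -> B y X Y Z + B y Y Z X + B y Z X Y = 0.
Proof.
move=> Uy.
apply: (lin3_ext (f := fun X Y Z => B y X Y Z + B y Y Z X + B y Z X Y)
  (h := fun _ _ _ => 0)) => *.
- by do !apply: lin_add; [apply: lin_ev3_1|apply: lin_ev3_3|apply: lin_ev3_2].
- by do !apply: lin_add; [apply: lin_ev3_2|apply: lin_ev3_1|apply: lin_ev3_3].
- by do !apply: lin_add; [apply: lin_ev3_3|apply: lin_ev3_2|apply: lin_ev3_1].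
- by move=> W; rewrite big1 // => i _; rewrite mulr0.
- by move=> W; rewrite big1 // => i _; rewrite mulr0.
- by move=> W; rewrite big1 // => i _; rewrite mulr0.
- by rewrite /B !ev3_delta torsOm_cycle.
Qed.

Lemma B_JJ y X Y Z : U y -> B y (X *m Jm y) (Y *m Jm y) Z = - B y X Y Z.
Proof.
move=> Uy.
apply: (lin3_ext (f := fun X Y Z => B y (X *m Jm y) (Y *m Jm y) Z)
  (h := fun X Y Z => - B y X Y Z)).
- by move=> Y' Z'; apply: (lin_mulr (f := fun X => B y X _ _)); apply: lin_ev3_1.
- by move=> X' Z'; apply: (lin_mulr (f := fun Y => B y _ Y _)); apply: lin_ev3_2.
- by move=> X' Y'; apply: lin_ev3_3.
- by move=> Y' Z'; apply: lin_opp; apply: lin_ev3_1.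
- by move=> X' Z'; apply: lin_opp; apply: lin_ev3_2.
- by move=> X' Y'; apply: lin_opp; apply: lin_ev3_3.
move=> i j k; rewrite /B [in RHS]ev3_delta.
rewrite (lin_row (Jm y) i (lin_ev3_1 (torsOm y) _ _)).
under eq_bigr => a _ do
  rewrite (lin_row (Jm y) j (lin_ev3_2 (torsOm y) 'e_a 'e_k)).
under eq_bigr do under eq_bigr do rewrite ev3_delta !comp_mxE.
rewrite /torsOm /lower.
rewrite [in RHS](eq_bigr (fun l => - \sum_a \sum_b
    J y i a * (J y j b * (tau y a b l * om y l k)))); last first.
  move=> l _; rewrite (G_torsion Uy) mulNr mulr_suml; congr (- _).
  apply: eq_bigr => a _; rewrite mulr_suml; apply: eq_bigr => b _.
  by rewrite !mulrA.
rewrite sumrN opprK exchange_big; apply: eq_bigr => a _ /=.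
rewrite mulr_sumr exchange_big; apply: eq_bigr => b _ /=.
by rewrite mxE !mulr_sumr.
Qed.

(** om(V, J Z) = g(J V, J Z) = g(V, Z), used in the matrix form [JgJ]. *)
Lemma T_B y X Y Z : U y -> T y X Y Z = B y X Y (Z *m Jm y).
Proof.
move=> Uy.
apply: (lin3_ext (f := T y) (h := fun X Y Z => B y X Y (Z *m Jm y))).
- by move=> Y' Z'; apply: lin_ev3_1.
- by move=> X' Z'; apply: lin_ev3_2.
- by move=> X' Y'; apply: lin_ev3_3.
- by move=> Y' Z'; apply: lin_ev3_1.
- by move=> X' Z'; apply: lin_ev3_2.
- by move=> X' Y'; apply: lin_mulr; apply: lin_ev3_3.
move=> i j k; rewrite [LHS]ev3_delta lin_row; last exact: lin_ev3_3.
under eq_bigr => b _ do rewrite [B y _ _ _]ev3_delta mulr_sumr.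
rewrite exchange_big; apply: eq_bigr => l _ /=.
rewrite -(comp_mxE g) -/(gm y) -(JgJ Uy) -omE // mxE mulr_sumr.
by apply: eq_bigr => b _; rewrite !mxE mulrA mulrC.
Qed.

Lemma mulJ y (X : V) : U y -> X *m Jm y *m Jm y = - X.
Proof. by move=> Uy; rewrite -mulmxA JmJm // mulmxN mulmx1. Qed.

Lemma B_J12 y X Y Z : U y -> B y (X *m Jm y) Y Z = B y X (Y *m Jm y) Z.
Proof.
move=> Uy; apply: (closed_torsion_J12 (J := mulmx^~ (Jm y))).
- by move=> W; apply: mulJ.
- by move=> *; apply: (linN (lin_ev3_1 (torsOm y) _ _)).
- by move=> *; apply: B_skew.
- by move=> *; apply: B_JJ.
Qed.

Lemma B_J23 y X Y Z : U y -> B y X (Y *m Jm y) Z = B y X Y (Z *m Jm y).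
Proof.
move=> Uy; apply: (closed_torsion_J23 (J := mulmx^~ (Jm y))).
- by move=> W; apply: mulJ.
- by move=> *; apply: (linN (lin_ev3_1 (torsOm y) _ _)).
- by move=> *; apply: (linN (lin_ev3_3 (torsOm y) _ _)).
- by move=> *; apply: B_skew.
- by move=> *; apply: B_JJ.
- by move=> *; apply: B_cycle.
Qed.

Lemma T_J2 y X Y Z : U y -> T y X (Y *m Jm y) Z = T y (X *m Jm y) Y Z.
Proof. by move=> Uy; rewrite !T_B // B_J12. Qed.

Lemma T_J3 y X Y Z : U y -> T y X Y (Z *m Jm y) = T y (X *m Jm y) Y Z.
Proof. by move=> Uy; rewrite !T_B // B_J12 // B_J23. Qed.

Lemma T_cycle y X Y Z : U y -> T y X Y Z + T y Y Z X + T y Z X Y = 0.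
Proof.
(* [J] is moved onto Y in all three terms, which leaves [B_cycle] at X, J Y, Z. *)
move=> Uy; rewrite !T_B // -(B_J23 X Y) // -(B_J23 Y Z) // -(B_J12 Y Z) //.
exact: B_cycle.
Qed.

(** Back to components, since the covariant derivative acts on component functions over [U]. *)
Lemma torsL_J2 y i j k : U y ->
  \sum_b J y j b * torsL y i b k = \sum_b J y i b * torsL y b j k.
Proof.
move=> Uy; have := T_J2 'e_i 'e_j 'e_k Uy.
rewrite (lin_row (f := fun X => T y X _ _)); last exact: lin_ev3_1.
rewrite (lin_row (f := fun X => T y _ X _)); last exact: lin_ev3_2.
rewrite /T; under eq_bigr do rewrite ev3_delta comp_mxE.
by under [in RHS]eq_bigr do rewrite ev3_delta comp_mxE.
Qed.

Lemma torsL_J3 y i j k : U y ->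
  \sum_b J y k b * torsL y i j b = \sum_b J y i b * torsL y b j k.
Proof.
move=> Uy; have := T_J3 'e_i 'e_j 'e_k Uy.
rewrite (lin_row (f := fun X => T y X _ _)); last exact: lin_ev3_1.
rewrite (lin_row (f := fun X => T y _ _ X)); last exact: lin_ev3_3.
rewrite /T; under eq_bigr do rewrite ev3_delta comp_mxE.
by under [in RHS]eq_bigr do rewrite ev3_delta comp_mxE.
Qed.

Lemma torsL_cycle y i j k : U y -> torsL y i j k + torsL y j k i + torsL y k i j = 0.
Proof. by move=> /(T_cycle 'e_i 'e_j 'e_k); rewrite /T !ev3_delta. Qed.

(** * The parallel metric and the covariant derivative of the torsion *)

Let dg y i j v : U y -> derivable (fun z => g z i j) y v.
Proof. by move=> Uy; apply: smooth_derivable Uy. Qed.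
Let dJ y i j v : U y -> derivable (fun z => J z i j) y v.
Proof. by move=> Uy; apply: smooth_derivable Uy. Qed.
Let d_om y i j v : U y -> derivable (fun z => om z i j) y v.
Proof.
move=> Uy; apply: (near_eq_derivable (f := fun z => \sum_a J z i a * g z j a)).
  by near=> z; rewrite om_form //; near: z; exact: open_nbhs_nbhs.
by apply: derivable_sumM => b; [apply: dJ|apply: dg].
Unshelve. all: by end_near. Qed.
Let om_pdC y a b i j : U y ->
  pd a (pd b (fun z => om z i j)) y = pd b (pd a (fun z => om z i j)) y.
Proof.
move=> Uy; have pd_om c z : U z -> pd c (fun z => om z i j) z =
    pd c (fun z => \sum_a J z i a * g z j a) z.
  by move=> Uz; apply: (eq_pd c oU Uz) => w Uw; rewrite om_form.
rewrite (eq_pd a oU Uy (pd_om b)) (eq_pd b oU Uy (pd_om a)).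
apply: (pd_pdC_sumM oU G_smooth Om_curvature _ _ _ _ Uy) => e.
- exact: J_smooth.
- exact: g_smooth.
Qed.
Let dG y i j k v : U y -> derivable (fun z => G z i j k) y v.
Proof. by move=> Uy; apply: smooth_derivable Uy. Qed.
Let dD y i j k v : U y -> derivable (fun z => D z i j k) y v.
Proof. by move=> Uy; apply: smooth_derivable Uy. Qed.
Let dtau y i j k v : U y -> derivable (fun z => tau z i j k) y v.
Proof. by move=> Uy; apply: derivableB; apply: dG. Qed.
Let dtorsL y i j k v : U y -> derivable (fun z => torsL z i j k) y v.
Proof.
by move=> Uy; apply: derivable_sumM => l; [apply: dtau|apply: dg].
Qed.

Lemma J_inj y (C : 'I_m -> R) : U y ->
  (forall i, \sum_b J y i b * C b = 0) -> forall i, C i = 0.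
Proof.
move=> Uy JC i; pose v : 'cV_m := \col_b C b.
have Jv : Jm y *m v = 0.
  apply/colP => j; rewrite !mxE -[RHS](JC j).
  by apply: eq_bigr => b _; rewrite !mxE.
have : v = 0.
  have := congr1 (mulmx (Jm y)) Jv.
  rewrite mulmxA JmJm // mulmx0 mulNmx mul1mx => /eqP.
  by rewrite oppr_eq0 => /eqP.
by move=> /colP/(_ i); rewrite !mxE.
Qed.

(** As [J] is parallel, contracting nabla g with [J] gives nabla om = 0; [J] is injective. *)
Lemma G_g y a i j : U y -> cov02 G g y a i j = 0.
Proof.
move=> Uy; move: i; apply: (J_inj Uy) => i.
have <- : cov02 G om y a i j = \sum_b J y i b * cov02 G g y a b j.
  rewrite -cov02_contract; first last.
  - by move=> k b; apply: G_J.
  - by move=> *; apply: dg.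
  - by move=> *; apply: dJ.
  apply: (eq_cov02 G oU a i j Uy) => z Uz k l; rewrite om_form //.
  by apply: eq_bigr => b _; rewrite (g_sym Uz l).
exact: G_om.
Qed.

Let nablaT y := cov03 G torsL y.

Lemma nablaT_skew y a i j k : U y -> nablaT y a i j k = - nablaT y a j i k.
Proof.
move=> Uy; rewrite /nablaT -(cov03_swap12 G torsL y a i j k).
suff : nablaT y a i j k + cov03 G (fun z i j k => torsL z j i k) y a i j k = 0.
  by move=> /eqP; rewrite addr_eq0 => /eqP.
rewrite /nablaT -cov03D; first last.
- by move=> *; apply: dtorsL.
- by move=> *; apply: dtorsL.
rewrite (eq_cov03 (T' := fun _ _ _ _ => 0) G oU _ _ _ _ Uy) ?cov03_0 // => z _ b c d.
by rewrite /torsL lower_torsion_skew addNr.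
Qed.

Lemma nablaT_cycle y a i j k : U y ->
  nablaT y a i j k + nablaT y a j k i + nablaT y a k i j = 0.
Proof.
move=> Uy; rewrite /nablaT -(cov03_rot G torsL y a i j k).
rewrite -(cov03_rot G torsL y a j k i) -(cov03_rot G _ y a i j k).
rewrite -cov03D; first last.
- by move=> *; apply: dtorsL.
- by move=> *; apply: dtorsL.
rewrite -cov03D; first last.
- by move=> *; apply: dtorsL.
- by move=> *; apply: derivableD; apply: dtorsL.
rewrite (eq_cov03 (T' := fun _ _ _ _ => 0) G oU _ _ _ _ Uy) ?cov03_0 // => z Uz b c d.
exact: torsL_cycle.
Qed.

Let JtorsL z i j k := \sum_b J z i b * torsL z b j k.

(** [JtorsL] is the common form for all three slots: by [torsL_J2] and [torsL_J3], inserting [J] in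
    any slot of the torsion gives this field on all of [U], so the derivatives agree too. *)
Lemma nablaT_J1 y a i j k : U y ->
  \sum_b J y i b * nablaT y a b j k = cov03 G JtorsL y a i j k.
Proof.
move=> Uy; rewrite /JtorsL cov03_contract // => *.
- exact: dJ.
- exact: dtorsL.
- exact: G_J.
Qed.

Lemma nablaT_J2 y a i j k : U y ->
  \sum_b J y j b * nablaT y a i b k = \sum_b J y i b * nablaT y a b j k.
Proof.
move=> Uy; rewrite nablaT_J1 // /nablaT.
under eq_bigr do rewrite -(cov03_swap12 G torsL).
rewrite -cov03_contract; first last.
- by move=> *; apply: G_J.
- by move=> *; apply: dtorsL.
- by move=> *; apply: dJ.
rewrite -(cov03_swap12 G JtorsL); apply: (eq_cov03 G oU _ _ _ _ Uy) => z Uz b c d.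
exact: torsL_J2.
Qed.

Lemma nablaT_J3 y a i j k : U y ->
  \sum_b J y k b * nablaT y a i j b = \sum_b J y i b * nablaT y a b j k.
Proof.
move=> Uy; rewrite nablaT_J1 // /nablaT.
under eq_bigr do rewrite -(cov03_rot G torsL).
rewrite -cov03_contract; first last.
- by move=> *; apply: G_J.
- by move=> *; apply: dtorsL.
- by move=> *; apply: dJ.
rewrite -(cov03_rot G JtorsL); apply: (eq_cov03 G oU _ _ _ _ Uy) => z Uz b c d.
exact: torsL_J3.
Qed.

Lemma nablaTE y a i j k : U y ->
  nablaT y a i j k = \sum_l cov12 G tau y a i j l * g y l k.
Proof.
move=> Uy; rewrite /nablaT /torsL cov03_lower // => *.
- exact: dg.
- exact: dtau.
- exact: G_g.
Qed.

(** * Symmetries of the Chern curvature and the first Bianchi identity *)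

Let OmL y a b c d := \sum_k Om y a b c k * g y k d.

Lemma OmL_skew3 y a b c d : U y -> OmL y a b c d = - OmL y a b d c.
Proof.
move=> Uy; have := parallel_curvature oU G_smooth Om_curvature dg
  (pd_pdC G_smooth Om_curvature a b (g_smooth c d) Uy)
  (fun y Uy a i j => G_g a i j Uy) Uy.
move=> /eqP; rewrite addr_eq0 => /eqP; rewrite /OmL => ->; congr (- _).
by apply: eq_bigr => e _; rewrite (g_sym Uy c).
Qed.

(** The curvature annihilates the parallel form [om]; together with [OmL_skew3] this means that it
    commutes with [J]. *)
Lemma OmL_J y a b c d : U y ->
  \sum_f J y d f * OmL y a b c f = - \sum_f J y c f * OmL y a b f d.
Proof.
move=> Uy; have := parallel_curvature oU G_smooth Om_curvature d_om
  (om_pdC a b c d Uy) G_om Uy.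
have E p q : \sum_e Om y a b p e * om y q e = \sum_f J y q f * OmL y a b p f.
  under eq_bigr do rewrite om_form // mulr_sumr.
  rewrite exchange_big; apply: eq_bigr => f _ /=; rewrite mulr_sumr.
  by apply: eq_bigr => e _; rewrite mulrCA.
rewrite E; under eq_bigr do rewrite (om_skew _ d Uy) mulrN.
rewrite sumrN E => /eqP; rewrite addrC subr_eq0 => /eqP <-.
by rewrite -sumrN; apply: eq_bigr => f _; rewrite OmL_skew3 // mulrN.
Qed.

Let pd_tau y a i j k : U y -> pd a (fun z => tau z i j k) y =
  pd a (fun z => G z i j k) y - pd a (fun z => G z j i k) y.
Proof. by move=> Uy; apply: deriveB; apply: dG. Qed.

(** The first Bianchi identity for a connection with torsion. The derivatives of [G] match in the
    cyclic sums, and what remains is quadratic in [G] and holds for each value of the summation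
    index. *)
Lemma bianchi_comp y a b c k : U y ->
  Om y a b c k + Om y b c a k + Om y c a b k =
  cov12 G tau y a b c k + cov12 G tau y b c a k + cov12 G tau y c a b k
  + \sum_e (tau y a b e * tau y e c k + tau y b c e * tau y e a k
            + tau y c a e * tau y e b k).
Proof.
move=> Uy; rewrite !(curvatureE G_smooth Om_curvature) // /curvature_of /cov12.
rewrite !pd_tau //.
pose S p q r := \sum_e (G y p e k * G y q r e - G y q e k * G y p r e).
pose C p q r := - \sum_e G y p q e * tau y e r k - \sum_e G y p r e * tau y q e k
  + \sum_e G y p e k * tau y q r e.
suff E : S a b c + S b c a + S c a b = C a b c + C b c a + C c a b
  + \sum_e (tau y a b e * tau y e c k + tau y b c e * tau y e a k
            + tau y c a e * tau y e b k).
  by move: E; rewrite /S /C; abstract_atoms; lra.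
rewrite /S /C -!sumrN -!big_split /=; apply: eq_bigr => e _.
rewrite /torsion; ring.
Qed.

Lemma bianchi_lower y a b c d : U y ->
  OmL y a b c d + OmL y b c a d + OmL y c a b d =
  nablaT y a b c d + nablaT y b c a d + nablaT y c a b d
  + \sum_e tau y a b e * torsL y e c d + \sum_e tau y b c e * torsL y e a d
  + \sum_e tau y c a e * torsL y e b d.
Proof.
move=> Uy; rewrite !nablaTE //.
have E p q r : \sum_e tau y p q e * torsL y e r d =
    \sum_k (\sum_e tau y p q e * tau y e r k) * g y k d.
  under eq_bigr do rewrite /torsL /lower mulr_sumr.
  rewrite exchange_big; apply: eq_bigr => k _ /=; rewrite mulr_suml.
  by apply: eq_bigr => e _; rewrite mulrA.
rewrite !E /OmL -!big_split /=; apply: eq_bigr => k _.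
rewrite -!mulrDl bianchi_comp // !big_split /= !addrA.
by [].
Qed.

(** * Comparison with the Levi-Civita connection *)

Let K z i j k := D z i j k - G z i j k.
Let dK y i j k v : U y -> derivable (fun z => K z i j k) y v.
Proof. by move=> Uy; apply: derivableB; [apply: dD|apply: dG]. Qed.

(* The difference of the two connections is determined by its torsion part
   and its skew-symmetry; the cyclic identity of the torsion simplifies it. *)
Lemma lower_K y i j k : U y -> lower K g y i j k = torsL y j k i.
Proof.
move=> Uy.
have skew a b c : lower K g y a b c = - lower K g y a c b.
  have := D_g Uy a b c; have := G_g a b c Uy; rewrite /cov02.
  rewrite /lower /K; under [in X in _ -> _ -> X]eq_bigr do rewrite mulrBl.
  under [in X in _ -> _ -> _ = X]eq_bigr do rewrite mulrBl (g_sym Uy _ b).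
  rewrite !sumrB; abstract_atoms; lra.
have tors a b c : lower K g y a b c - lower K g y b a c = - torsL y a b c.
  rewrite -sumrB -sumrN; apply: eq_bigr => l _.
  have := D_torsion Uy a b l; rewrite /torsion /K => DE.
  by rewrite -mulrBl -mulNr; congr (_ * _); lra.
have := skew i j k; have := skew j k i; have := skew k i j.
have := tors i j k; have := tors j k i; have := tors k i j.
have := torsL_cycle i j k Uy.
move: (lower K g y) (torsL y) => L T'; lra.
Qed.

Lemma cov_K y a b d k : U y ->
  \sum_l cov12 G K y a b d l * g y l k = nablaT y a d k b.
Proof.
move=> Uy; rewrite -cov03_lower; first last.
- by move=> *; apply: G_g.
- by move=> *; apply: dK.
- by move=> *; apply: dg.
rewrite /nablaT -(cov03_rot G torsL); apply: (eq_cov03 G oU _ _ _ _ Uy) => z Uz i j l.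
exact: lower_K.
Qed.

(** The curvature of nabla + K. Since [cov12] also acts on the direction index of [K],
    antisymmetrising it produces a torsion term, which the sum of [tau] times [K] compensates. *)
Lemma curvature_D y a b d k : U y ->
  Rm y a b d k = Om y a b d k + cov12 G K y a b d k - cov12 G K y b a d k
    + \sum_e tau y a b e * K y e d k + \sum_e K y b d e * K y a e k
    - \sum_e K y a d e * K y b e k.
Proof.
move=> Uy; rewrite (curvatureE D_smooth Rm_curvature) //.
rewrite (curvatureE G_smooth Om_curvature) // /curvature_of /cov12.
have pdK c p q r : pd c (fun z => K z p q r) y =
    pd c (fun z => D z p q r) y - pd c (fun z => G z p q r) y.
  by apply: deriveB; [apply: dD|apply: dG].
rewrite !pdK.
pose S (H : comp3 R m) := \sum_e (H y a e k * H y b d e - H y b e k * H y a d e).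
pose C p q := - \sum_e G y p q e * K y e d k - \sum_e G y p d e * K y q e k
  + \sum_e G y p e k * K y q d e.
suff E : S D = S G + C a b - C b a
    + \sum_e tau y a b e * K y e d k + \sum_e K y b d e * K y a e k
    - \sum_e K y a d e * K y b e k.
  by move: E; rewrite /S /C; abstract_atoms; lra.
rewrite /S /C -!sumrN !opprD -!sumrN -!big_split /=; apply: eq_bigr => e _.
rewrite /torsion /K; ring.
Qed.

(** Torsion and difference tensor as vectors, obtained by raising a slot of [T] so that their
    [J]-rules follow from those of [T]. [tauv_delta] and [Kv_delta] recover the components. *)
Let tauv y X Y := sharp (gi y) (T y X Y).
Let Kv y X Y := sharp (gi y) (fun Z => T y Y Z X).
Let N y := ev4 (nablaT y).
Let O y := ev4 (OmL y).

Lemma inner_delta y (X : V) j : inner (gm y) X 'e_j = \sum_i X 0 i * g y i j.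
Proof. by apply: eq_bigr => i _; rewrite ev1_delta mxE. Qed.

Lemma tauv_delta y a b : U y -> tauv y 'e_a 'e_b = \row_e tau y a b e.
Proof.
move=> Uy; apply/esym/(sharp_unique (gEi Uy)).
apply: lin_ext => [||j]; [exact: lin_ev2_2 | exact: lin_ev3_3 |].
rewrite inner_delta [RHS]ev3_delta.
by apply: eq_bigr => i _; rewrite mxE.
Qed.

Lemma Kv_delta y a b : U y -> Kv y 'e_a 'e_b = \row_e K y a b e.
Proof.
move=> Uy; apply/esym/(sharp_unique (gEi Uy)).
apply: lin_ext => [||j]; [exact: lin_ev2_2 | exact: lin_ev3_2 |].
rewrite inner_delta [RHS]ev3_delta -lower_K //.
by apply: eq_bigr => i _; rewrite mxE.
Qed.

Lemma innerJ y (X Y : V) : U y ->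
  inner (gm y) (X *m Jm y) Y = - inner (gm y) X (Y *m Jm y).
Proof.
move=> Uy.
have E (X' Y' : V) : inner (gm y) X' Y' = (X' *m gm y *m Y'^T) 0 0.
  rewrite mxE /inner /ev2 /ev1; under [RHS]eq_bigr do rewrite !mxE mulr_suml.
  rewrite exchange_big; apply: eq_bigr => i _ /=; rewrite mulr_sumr.
  by apply: eq_bigr => j _; rewrite mulrAC mulrA.
rewrite !E -[X *m Jm y *m gm y]mulmxA Jg // mulmxN mulNmx mxE.
by rewrite trmx_mul !mulmxA.
Qed.

(** [J] passes from the first slot of [T] to the third, which is paired with tau(X, Y) by the
    metric; [innerJ] then moves it onto tau(X, Y) with a sign. *)
Lemma tauv_J1 y (X Y : V) : U y -> tauv y (X *m Jm y) Y = - (tauv y X Y *m Jm y).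
Proof.
move=> Uy; apply/esym/(sharp_unique (gEi Uy)) => Z.
rewrite [LHS](linN (lin_ev2_1 _ Z)) -/(inner (gm y) _ Z) innerJ // opprK.
by rewrite (sharpP (giE Uy)) ?T_J3 //; apply: lin_ev3_3.
Qed.

Lemma tauv_J2 y (X Y : V) : U y -> tauv y X (Y *m Jm y) = - (tauv y X Y *m Jm y).
Proof.
move=> Uy; rewrite -tauv_J1 //; congr sharp; apply/funext => Z.
exact: T_J2.
Qed.

Lemma Kv_J y (X Y : V) : U y -> Kv y X (Y *m Jm y) = Kv y (X *m Jm y) Y.
Proof.
by move=> Uy; congr sharp; apply/funext => Z; rewrite T_J3.
Qed.

(** * Multilinear extension of the component identities *)

Lemma N_J2 y W X Y Z : U y -> N y W X (Y *m Jm y) Z = N y W (X *m Jm y) Y Z.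
Proof.
move=> Uy; apply: (lin4_ext (f := fun W X Y Z => N y W X (Y *m Jm y) Z)
  (h := fun W X Y Z => N y W (X *m Jm y) Y Z)).
- by move=> *; apply: lin_ev4_1.
- by move=> *; apply: lin_ev4_2.
- by move=> W' X' Z'; apply: (lin_mulr (Jm y) (lin_ev4_3 (nablaT y) W' X' Z')).
- by move=> *; apply: lin_ev4_4.
- by move=> *; apply: lin_ev4_1.
- by move=> W' Y' Z'; apply: (lin_mulr (Jm y) (lin_ev4_2 (nablaT y) W' Y' Z')).
- by move=> *; apply: lin_ev4_3.
- by move=> *; apply: lin_ev4_4.
move=> a i j k; rewrite /N (lin_row _ _ (lin_ev4_3 (nablaT y) 'e_a 'e_i 'e_k)).
rewrite (lin_row _ _ (lin_ev4_2 (nablaT y) 'e_a 'e_j 'e_k)).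
under eq_bigr do rewrite ev4_delta comp_mxE.
under [in RHS]eq_bigr do rewrite ev4_delta comp_mxE.
exact: nablaT_J2.
Qed.

Lemma N_J3 y W X Y Z : U y -> N y W X Y (Z *m Jm y) = N y W (X *m Jm y) Y Z.
Proof.
move=> Uy; apply: (lin4_ext (f := fun W X Y Z => N y W X Y (Z *m Jm y))
  (h := fun W X Y Z => N y W (X *m Jm y) Y Z)).
- by move=> *; apply: lin_ev4_1.
- by move=> *; apply: lin_ev4_2.
- by move=> *; apply: lin_ev4_3.
- by move=> *; apply: lin_mulr; apply: lin_ev4_4.
- by move=> *; apply: lin_ev4_1.
- by move=> W' Y' Z'; apply: (lin_mulr (Jm y) (lin_ev4_2 (nablaT y) W' Y' Z')).
- by move=> *; apply: lin_ev4_3.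
- by move=> *; apply: lin_ev4_4.
move=> a i j k; rewrite /N (lin_row _ _ (lin_ev4_4 (nablaT y) 'e_a 'e_i 'e_j)).
rewrite (lin_row _ _ (lin_ev4_2 (nablaT y) 'e_a 'e_j 'e_k)).
under eq_bigr do rewrite ev4_delta comp_mxE.
under [in RHS]eq_bigr do rewrite ev4_delta comp_mxE.
exact: nablaT_J3.
Qed.

Lemma N_skew y W X Y Z : U y -> N y W X Y Z = - N y W Y X Z.
Proof.
move=> Uy; apply: (lin4_ext (f := N y) (h := fun W X Y Z => - N y W Y X Z)).
- by move=> *; apply: lin_ev4_1.
- by move=> *; apply: lin_ev4_2.
- by move=> *; apply: lin_ev4_3.
- by move=> *; apply: lin_ev4_4.
- by move=> *; apply: lin_opp; apply: lin_ev4_1.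
- by move=> *; apply: lin_opp; apply: lin_ev4_3.
- by move=> *; apply: lin_opp; apply: lin_ev4_2.
- by move=> *; apply: lin_opp; apply: lin_ev4_4.
by move=> a i j k; rewrite /N !ev4_delta nablaT_skew.
Qed.

Lemma lin_0 : linear_form (fun _ : V => 0).
Proof. by move=> X; rewrite big1 // => i _; rewrite mulr0. Qed.

Lemma N_cycle y W X Y Z : U y -> N y W X Y Z + N y W Y Z X + N y W Z X Y = 0.
Proof.
move=> Uy; apply: (lin4_ext
  (f := fun W X Y Z => N y W X Y Z + N y W Y Z X + N y W Z X Y)
  (h := fun _ _ _ _ => 0)) => *; try exact: lin_0.
- by do !apply: lin_add; apply: lin_ev4_1.
- by do !apply: lin_add; [apply: lin_ev4_2|apply: lin_ev4_4|apply: lin_ev4_3].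
- by do !apply: lin_add; [apply: lin_ev4_3|apply: lin_ev4_2|apply: lin_ev4_4].
- by do !apply: lin_add; [apply: lin_ev4_4|apply: lin_ev4_3|apply: lin_ev4_2].
- by rewrite /N !ev4_delta nablaT_cycle.
Qed.

Lemma O_skew3 y X Y Z W : U y -> O y X Y Z W = - O y X Y W Z.
Proof.
move=> Uy; apply: (lin4_ext (f := O y) (h := fun X Y Z W => - O y X Y W Z)).
- by move=> *; apply: lin_ev4_1.
- by move=> *; apply: lin_ev4_2.
- by move=> *; apply: lin_ev4_3.
- by move=> *; apply: lin_ev4_4.
- by move=> *; apply: lin_opp; apply: lin_ev4_1.
- by move=> *; apply: lin_opp; apply: lin_ev4_2.
- by move=> *; apply: lin_opp; apply: lin_ev4_4.
- by move=> *; apply: lin_opp; apply: lin_ev4_3.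
by move=> a b c d; rewrite /O !ev4_delta OmL_skew3.
Qed.

Lemma O_J y X Y Z W : U y -> O y X Y Z (W *m Jm y) = - O y X Y (Z *m Jm y) W.
Proof.
move=> Uy; apply: (lin4_ext (f := fun X Y Z W => O y X Y Z (W *m Jm y))
  (h := fun X Y Z W => - O y X Y (Z *m Jm y) W)).
- by move=> *; apply: lin_ev4_1.
- by move=> *; apply: lin_ev4_2.
- by move=> *; apply: lin_ev4_3.
- by move=> *; apply: lin_mulr; apply: lin_ev4_4.
- by move=> *; apply: lin_opp; apply: lin_ev4_1.
- by move=> *; apply: lin_opp; apply: lin_ev4_2.
- by move=> X' Y' W'; apply: lin_opp; apply: (lin_mulr (Jm y) (lin_ev4_3 (OmL y) X' Y' W')).
- by move=> *; apply: lin_opp; apply: lin_ev4_4.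
move=> a b c d; rewrite /O (lin_row _ _ (lin_ev4_4 (OmL y) 'e_a 'e_b 'e_c)).
rewrite (lin_row _ _ (lin_ev4_3 (OmL y) 'e_a 'e_b 'e_d)).
under eq_bigr do rewrite ev4_delta comp_mxE.
under [in RHS]eq_bigr do rewrite ev4_delta comp_mxE.
exact: OmL_J.
Qed.

Lemma linv_tauv1 y Y : linear_op (tauv y ^~ Y).
Proof. by apply: linv_sharp => Z; apply: lin_ev3_1. Qed.
Lemma linv_tauv2 y X : linear_op (tauv y X).
Proof. by apply: (@linv_sharp _ _ (gi y) (T y X)) => Z; apply: lin_ev3_2. Qed.
Lemma linv_Kv1 y Y : linear_op (Kv y ^~ Y).
Proof. by apply: (@linv_sharp _ _ (gi y) (fun X Z => T y Y Z X)) => Z; apply: lin_ev3_3. Qed.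
Lemma linv_Kv2 y X : linear_op (Kv y X).
Proof. by apply: (@linv_sharp _ _ (gi y) (fun Y Z => T y Y Z X)) => Z; apply: lin_ev3_1. Qed.

Let q y X Y Z W := T y (tauv y X Y) Z W.

Let lin_q1 y Y Z W : linear_form (fun X => q y X Y Z W).
Proof. exact: (lin_comp (lin_ev3_1 (torsL y) Z W) (linv_tauv1 y Y)). Qed.
Let lin_q2 y X Z W : linear_form (fun Y => q y X Y Z W).
Proof. exact: (lin_comp (lin_ev3_1 (torsL y) Z W) (linv_tauv2 y X)). Qed.
Let lin_q3 y X Y W : linear_form (fun Z => q y X Y Z W).
Proof. exact: lin_ev3_2. Qed.
Let lin_q4 y X Y Z : linear_form (q y X Y Z).
Proof. exact: lin_ev3_3. Qed.

Lemma bianchi_vec y X Y Z W : U y ->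
  O y X Y Z W + O y Y Z X W + O y Z X Y W =
    N y X Y Z W + N y Y Z X W + N y Z X Y W
    + T y (tauv y X Y) Z W + T y (tauv y Y Z) X W + T y (tauv y Z X) Y W.
Proof.
move=> Uy; rewrite -/(q y X Y Z W) -/(q y Y Z X W) -/(q y Z X Y W).
apply: (lin4_ext (f := fun X Y Z W => O y X Y Z W + O y Y Z X W + O y Z X Y W)
  (h := fun X Y Z W => N y X Y Z W + N y Y Z X W + N y Z X Y W
    + q y X Y Z W + q y Y Z X W + q y Z X Y W)) => *.
- by do !apply: lin_add; [apply: lin_ev4_1|apply: lin_ev4_3|apply: lin_ev4_2].
- by do !apply: lin_add; [apply: lin_ev4_2|apply: lin_ev4_1|apply: lin_ev4_3].
- by do !apply: lin_add; [apply: lin_ev4_3|apply: lin_ev4_2|apply: lin_ev4_1].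
- by do !apply: lin_add; apply: lin_ev4_4.
- by do !apply: lin_add; [apply: lin_ev4_1|apply: lin_ev4_3|apply: lin_ev4_2
                         |apply: lin_q1|apply: lin_q3|apply: lin_q2].
- by do !apply: lin_add; [apply: lin_ev4_2|apply: lin_ev4_1|apply: lin_ev4_3
                         |apply: lin_q2|apply: lin_q1|apply: lin_q3].
- by do !apply: lin_add; [apply: lin_ev4_3|apply: lin_ev4_2|apply: lin_ev4_1
                         |apply: lin_q3|apply: lin_q2|apply: lin_q1].
- by do !apply: lin_add; [apply: lin_ev4_4|apply: lin_ev4_4|apply: lin_ev4_4
                         |apply: lin_q4|apply: lin_q4|apply: lin_q4].
have qE a b c d : q y 'e_a 'e_b 'e_c 'e_d = \sum_e tau y a b e * torsL y e c d.
  rewrite /q tauv_delta // [LHS](lin_ev3_1 (torsL y)).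
  by apply: eq_bigr => e _; rewrite mxE ev3_delta.
by rewrite /O /N !ev4_delta !qE bianchi_lower.
Qed.

Local Notation ricci y := (ricci_form (gi y) (tauv y) (Kv y) (T y) (N y) (O y)).

Lemma flow_vec y X Y : U y ->
  let P := P_form (gi y) (Jm y) (O y) in
  - (2^-1 * (P X Y - P (X *m Jm y) (Y *m Jm y))
     - (ricci y (X *m Jm y) Y - ricci y (X *m Jm y *m Jm y) (Y *m Jm y))) =
  4 * mtrace (gi y) (fun z w => N y (z *m Jm y) w X Y).
Proof.
move=> Uy P; apply: flow_identity.
- exact: gi_sym.
- exact: JmJm.
- exact: giJ.
- exact: linv_tauv1.
- exact: linv_Kv1.
- by move=> *; apply: lin_ev3_1.
- by move=> *; apply: lin_ev3_2.
- by move=> *; apply: lin_ev3_3.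
- by move=> *; apply: lin_ev4_1.
- by move=> *; apply: lin_ev4_2.
- by move=> *; apply: lin_ev4_3.
- by move=> *; apply: lin_ev4_4.
- by move=> *; apply: lin_ev4_1.
- by move=> *; apply: lin_ev4_3.
- by move=> *; apply: lin_ev4_4.
- by move=> *; apply: tauv_J1.
- by move=> *; apply: tauv_J2.
- by move=> *; apply: Kv_J.
- by move=> *; apply: T_J2.
- by move=> *; apply: T_J3.
- by move=> *; apply: N_J2.
- by move=> *; apply: N_J3.
- by move=> *; apply: N_skew.
- by move=> *; apply: N_cycle.
- by move=> *; apply: O_skew3.
- by move=> *; apply: O_J.
- by move=> *; apply: bianchi_vec.
Qed.

(** * The flow equation in components *)

Variable Rc : comp2 R m.
Hypothesis RcE : forall y, U y -> forall b d, Rc y b d = \sum_a Rm y a b d a.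

Lemma raise_lower y (F : 'I_m -> R) k : U y ->
  \sum_l (\sum_c F c * g y c l) * gi y l k = F k.
Proof.
move=> Uy; under eq_bigr do rewrite mulr_suml.
rewrite exchange_big /= -[RHS](ev1_delta F); apply: eq_bigr => c _.
transitivity (F c * (gm y *m gi y) c k).
  by rewrite mxE mulr_sumr; apply: eq_bigr => l _; rewrite mxE mulrA.
by rewrite gEi // !mxE eqxx /= mulrC.
Qed.

Lemma gi_symE y i j : U y -> gi y i j = gi y j i.
Proof. by move=> Uy; rewrite -[in LHS]gi_sym // mxE. Qed.

(** The trace of [Rm] over its upper index is rewritten with the metric and its inverse, so that
    each term of [curvature_D] can be lowered and matched with one term of [ricci_form]. *)
Lemma ricci_delta y b d : U y -> ricci y 'e_b 'e_d = Rc y b d.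
Proof.
move=> Uy; rewrite RcE //; apply: eq_bigr => a _.
rewrite -[RHS](raise_lower (fun c => Rm y a b d c) a Uy).
apply: eq_bigr => l _; rewrite mulrC gi_symE //; congr (_ * _).
under [RHS]eq_bigr do rewrite curvature_D //.
have E (C : 'I_m -> R) p :
    \sum_c (\sum_e C e * K y p e c) * g y c l = \sum_e C e * torsL y e l p.
  under eq_bigr do rewrite mulr_suml.
  rewrite exchange_big; apply: eq_bigr => e _ /=.
  rewrite -lower_K // mulr_sumr.
  by apply: eq_bigr => c _; rewrite mulrA.
have E' : \sum_c (\sum_e tau y a b e * K y e d c) * g y c l =
    \sum_e tau y a b e * torsL y d l e.
  under eq_bigr do rewrite mulr_suml.
  rewrite exchange_big; apply: eq_bigr => e _ /=.
  rewrite -lower_K // mulr_sumr.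
  by apply: eq_bigr => c _; rewrite mulrA.
have -> : \sum_c (Om y a b d c + cov12 G K y a b d c - cov12 G K y b a d c
      + \sum_e tau y a b e * K y e d c + \sum_e K y b d e * K y a e c
      - \sum_e K y a d e * K y b e c) * g y c l =
    OmL y a b d l + nablaT y a d l b - nablaT y b d l a
    + \sum_e tau y a b e * torsL y d l e + \sum_e K y b d e * torsL y e l a
    - \sum_e K y a d e * torsL y e l b.
  rewrite -!E -E' -!cov_K // /OmL -!sumrN -!big_split /=.
  by apply: eq_bigr => c _; ring.
rewrite /O /N !ev4_delta tauv_delta // !Kv_delta //.
rewrite [T y _ _ _](lin_ev3_3 (torsL y)).
rewrite [T y (\row_e K y b d e) _ _](lin_ev3_1 (torsL y)).
rewrite [T y (\row_e K y a d e) _ _](lin_ev3_1 (torsL y)).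
under eq_bigr do rewrite mxE ev3_delta.
under [X in _ + X - _]eq_bigr do rewrite mxE ev3_delta.
by under [X in _ - X = _]eq_bigr do rewrite mxE ev3_delta.
Qed.

Lemma P_delta y a b : U y ->
  P_form (gi y) (Jm y) (O y) 'e_a 'e_b = chern_P g J Om y a b.
Proof.
move=> Uy; rewrite /P_form /mtrace /chern_P /form_inv.
transitivity (\sum_c \sum_d \sum_s J y s c * gi y d s * OmL y a b c d).
  rewrite [RHS]exchange_big /= exchange_big; apply: eq_bigr => d _ /=.
  rewrite exchange_big; apply: eq_bigr => s _ /=.
  rewrite /O (lin_row _ _ (lin_ev4_3 (OmL y) 'e_a 'e_b 'e_d)) mulr_sumr.
  apply: eq_bigr => c _; rewrite ev4_delta mxE gi_symE // mulrCA.
  by rewrite mulrA.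
by apply: eq_bigr => c _; apply: eq_bigr => d _; rewrite mulr_suml.
Qed.

Lemma lin_P1 y Y : linear_form (fun X => P_form (gi y) (Jm y) (O y) X Y).
Proof.
apply: (@lin_mtrace _ _ (gi y) (fun X z w => O y X Y (z *m Jm y) w)) => z w.
exact: lin_ev4_1.
Qed.

Lemma lin_P2 y X : linear_form (P_form (gi y) (Jm y) (O y) X).
Proof.
apply: (@lin_mtrace _ _ (gi y) (fun Y z w => O y X Y (z *m Jm y) w)) => z w.
exact: lin_ev4_2.
Qed.

Lemma lin_ricci1 y Y : linear_form (fun X => ricci y X Y).
Proof.
apply: (@lin_mtrace _ _ (gi y) (fun X z w => O y z X Y w + N y z Y w X - N y X Y w z
  + T y Y w (tauv y z X) + T y (Kv y X Y) w z - T y (Kv y z Y) w X)) => z w.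
do !apply: lin_add.
- exact: lin_ev4_2.
- exact: lin_ev4_4.
- by apply: lin_opp; apply: lin_ev4_1.
- exact: (lin_comp (lin_ev3_3 (torsL y) Y w) (linv_tauv2 y z)).
- exact: (lin_comp (lin_ev3_1 (torsL y) w z) (linv_Kv1 y Y)).
- by apply: lin_opp; apply: lin_ev3_3.
Qed.

Lemma lin_ricci2 y X : linear_form (ricci y X).
Proof.
apply: (@lin_mtrace _ _ (gi y) (fun Y z w => O y z X Y w + N y z Y w X - N y X Y w z
  + T y Y w (tauv y z X) + T y (Kv y X Y) w z - T y (Kv y z Y) w X)) => z w.
do !apply: lin_add.
- exact: lin_ev4_3.
- exact: lin_ev4_2.
- by apply: lin_opp; apply: lin_ev4_2.
- exact: lin_ev3_1.
- exact: (lin_comp (lin_ev3_1 (torsL y) w z) (linv_Kv2 y X)).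
- by apply: lin_opp; apply: (lin_comp (lin_ev3_1 (torsL y) w X) (linv_Kv2 y z)).
Qed.

Lemma anti_partE y (A : comp2 R m) (F : V -> V -> R) :
  (forall Y, linear_form (F^~ Y)) -> (forall X, linear_form (F X)) ->
  (forall i j, F 'e_i 'e_j = A y i j) -> forall i j,
  anti_part J A y i j = 2^-1 * (F 'e_i 'e_j - F ('e_i *m Jm y) ('e_j *m Jm y)).
Proof.
move=> F1 F2 FA i j; rewrite /anti_part FA; congr (_ * (_ - _)).
rewrite [RHS](lin_row _ _ (F1 _)); apply: eq_bigr => s _.
rewrite (lin_row _ _ (F2 _)) mulr_sumr; apply: eq_bigr => u _.
by rewrite FA !comp_mxE mulrA.
Qed.

Lemma flow_lowered y i w : U y ->
  - (anti_part J (chern_P g J Om) y i w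
     - 2 * \sum_e J y i e * anti_part J Rc y e w) =
  4 * mtrace (gi y) (fun z v => N y (z *m Jm y) v 'e_i 'e_w).
Proof.
move=> Uy; rewrite -flow_vec //; congr (- (_ - _)).
  apply: anti_partE; [exact: lin_P1|exact: lin_P2|].
  by move=> a b; apply: P_delta.
under eq_bigr do rewrite (anti_partE (lin_ricci1 y) (lin_ricci2 y)
  (fun a b => ricci_delta a b Uy)) mulrCA.
rewrite -mulr_sumr mulrA mulfV ?mul1r; last by rewrite pnatr_eq0.
under eq_bigr do rewrite mulrBr.
rewrite sumrB [X in _ = X - _](lin_row _ _ (lin_ricci1 y _)).
rewrite [X in _ = _ - X](lin_row _ _ (lin_mulr (Jm y) (lin_ricci1 y _))).
by congr (_ - _); apply: eq_bigr => e _; rewrite comp_mxE.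
Qed.

Lemma flow_local y i k : U y ->
  - \sum_w (anti_part J (chern_P g J Om) y i w
      - 2 * \sum_e J y i e * anti_part J Rc y e w) * metric_inv g y w k =
  4 * \sum_r \sum_e form_inv g J y r e * cov12 G tau y r e i k.
Proof.
move=> Uy; rewrite -sumrN.
under eq_bigr do rewrite -mulNr flow_lowered // -mulrA.
rewrite -mulr_sumr; congr (_ * _).
(* As om^re = J_s^r g^es, the trace with [J] in the direction slot is the contraction with
   [form_inv]. *)
transitivity (\sum_w (\sum_r \sum_e form_inv g J y r e * nablaT y r e i w) * gi y w k).
  apply: eq_bigr => w _; congr (_ * _); rewrite /mtrace [LHS]exchange_big [RHS]exchange_big /=.
  apply: eq_bigr => e _; rewrite /form_inv.
  under [RHS]eq_bigr do rewrite mulr_suml.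
  rewrite [RHS]exchange_big; apply: eq_bigr => s _ /=.
  rewrite /N (lin_row _ _ (lin_ev4_1 (nablaT y) 'e_e 'e_i 'e_w)) mulr_sumr.
  apply: eq_bigr => r _; rewrite ev4_delta mxE gi_symE // mulrCA.
  by rewrite mulrA.
under eq_bigr do rewrite mulr_suml.
rewrite exchange_big; apply: eq_bigr => r _ /=.
under eq_bigr do rewrite mulr_suml.
rewrite exchange_big; apply: eq_bigr => e _ /=.
(* [nablaTE] exhibits the lowered torsion index w, and [raise_lower] turns it back into the upper
   index k. *)
under eq_bigr do rewrite nablaTE // -mulrA.
by rewrite -mulr_sumr raise_lower.
Qed.

End LocalAlmostKahler.

Theorem propositionA (R : realType) (n : nat) (M : topologicalType)
    (A : smooth_manifold R n.*2 M) (I : set R)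
    (om J g : R -> A -> comp2 R n.*2) (G : R -> A -> comp3 R n.*2)
    (Om : R -> A -> comp4 R n.*2) (Rc : R -> A -> comp2 R n.*2)
    (flow : symplectic_curvature_flow I om J g G Om Rc)
    (t : R) (It : I t) (c : A) (x : 'rV[R]_(n.*2)) (Ux : chart_image c x)
    (i k : 'I_(n.*2)) :
  has_time_derivative I (fun s => J s c x i k) t
    (4 * \sum_r \sum_e
       form_inv (g t c) (J t c) x r e *
       cov12 (G t c) (torsion (G t c)) x r e i k).
Proof.
have [gR JC isom om_form om_closed] := scf_almost_kahler flow It.
have [Gfield G_om G_J G_tors] := scf_chern flow It.
have [D [Rm [[Dfield D_g D_tors] Rm_curv RcE]]] := scf_ricci flow It.
have [g_field g_sym g_pos] := gR.
have [J_field J_sq] := JC.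
have Om_curv : is_curvature (chart_image c) (G t c) (Om t c).
  exact: (scf_curvature flow It).
(* The flow supplies the time derivative; only its value, at fixed t and in one chart, is
   rewritten. *)
have := @scf_complex _ _ _ _ _ _ _ _ _ _ _ flow t It c x Ux i k.
by rewrite -(flow_local (open_image (c := c))
  (covariant2_smooth g_field (c := c)) (endomorphism_smooth J_field (c := c))
  (connection_smooth Gfield (c := c)) (connection_smooth Dfield (c := c))
  (g_sym c) (g_pos c) (J_sq c) (isom c) (om_form c) (om_closed c) (G_om c)
  (G_J c) (G_tors c) (D_g c) (D_tors c) Om_curv (Rm_curv c) (RcE c) i k Ux).
Qed.
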